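(* Consider the system $$\mathfrak r^1_t+(\mathfrak r^1+\mathfrak r^2+1)\mathfrak r^1_x=0,\qquad \mathfrak r^2_t+(\mathfrak r^1+\mathfrak r^2-1)\mathfrak r^2_x=0,\qquad \mathfrak r^3_t+(\mathfrak r^1+\mathfrak r^2)\mathfrak r^3_x=0$$ for unknown functions $\mathfrak r^1,\mathfrak r^2,\mathfrak r^3$ of $(t,x)$. The general solution of this system (that is, locally, all solutions except those with $\mathfrak r^i_x=0$ for some $i\in\{1,2,3\}$) has the implicit representation $$x-(\mathfrak r^1+\mathfrak r^2+1)t=\Phi+\Phi_1,$$ $$x-(\mathfrak r^1+\mathfrak r^2-1)t=\Phi-\Phi_2,$$ $$x-(\mathfrak r^1+\mathfrak r^2)t=\Phi+F e^{\mathfrak r^2-\mathfrak r^1},$$ where $F$ is an arbitrary smooth function of $\mathfrak r^3$ with $F_{\mathfrak r^3}\neq0$ and the function $\Phi=\Phi(\mathfrak r^1,\mathfrak r^2)$ runs through the set of solutions of the equation $2\Phi_{12}=\Phi_1-\Phi_2$ with $\Phi_{11}\neq-\Phi_{12}$ or, equivalently, $\Phi_{22}\neq-\Phi_{12}$.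
   Context: Subscripts $1,2$ on $\Phi$ denote partial derivatives with respect to $\mathfrak r^1$ and $\mathfrak r^2$. All functions are smooth and the considerations are local; the representation determines $(\mathfrak r^1,\mathfrak r^2,\mathfrak r^3)$ implicitly as functions of $(t,x)$. The conditions $\Phi_{11}\neq-\Phi_{12}$ and $\Phi_{22}\neq-\Phi_{12}$ mean that the respective equality does not hold identically, and their equivalence is understood on the set of solutions of $2\Phi_{12}=\Phi_1-\Phi_2$. *)

(* Defs.v *)
From Stdlib Require Import Reals.
From Coquelicot Require Import Coquelicot.
Open Scope R_scope.

Definition D1 (f : R -> R -> R) (x y : R) : R := Derive (fun z => f z y) x.
Definition D2 (f : R -> R -> R) (x y : R) : R := Derive (fun z => f x z) y.

Definition open2 (U : R -> R -> Prop) : Prop :=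
  forall x y, U x y -> locally_2d U x y.

(* [Ck n U f]: all partial derivatives of f of order at most n exist and those
   of order n are continuous on U.  For open U this is the usual C^n. *)
Fixpoint Ck (n : nat) (U : R -> R -> Prop) (f : R -> R -> R) : Prop :=
  match n with
  | O => forall x y, U x y -> continuity_2d_pt f x y
  | S m =>
      (forall x y, U x y ->
         ex_derive (fun z => f z y) x /\ ex_derive (fun z => f x z) y)
      /\ Ck m U (D1 f) /\ Ck m U (D2 f)
  end.

Definition smooth2 (U : R -> R -> Prop) (f : R -> R -> R) : Prop :=
  forall n, Ck n U f.

Definition smooth1 (J : R -> Prop) (F : R -> R) : Prop :=
  forall n s, J s -> ex_derive_n F n s.

(* The unknowns are functions of (t, x), so D1 is d/dt and D2 is d/dx. *)
Definition solves_system (Omega : R -> R -> Prop) (r1 r2 r3 : R -> R -> R)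
  : Prop :=
  forall t x, Omega t x ->
       D1 r1 t x + (r1 t x + r2 t x + 1) * D2 r1 t x = 0
    /\ D1 r2 t x + (r1 t x + r2 t x - 1) * D2 r2 t x = 0
    /\ D1 r3 t x + (r1 t x + r2 t x) * D2 r3 t x = 0.

(* In functions of (a, b) = (r^1, r^2), D1 and D2 are the derivatives denoted
   by the subscripts 1 and 2; Phi_12 is [D2 (D1 Phi)]. *)
Definition solves_Phi_eq (U : R -> R -> Prop) (Phi : R -> R -> R) : Prop :=
  open2 U /\ smooth2 U Phi /\
  forall a b, U a b -> 2 * D2 (D1 Phi) a b = D1 Phi a b - D2 Phi a b.

Definition Phi11_ne (Phi : R -> R -> R) (a b : R) : Prop :=
  D1 (D1 Phi) a b <> - D2 (D1 Phi) a b.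

Definition Phi22_ne (Phi : R -> R -> R) (a b : R) : Prop :=
  D2 (D2 Phi) a b <> - D2 (D1 Phi) a b.

(* The inequality on Phi means that the equality does not hold identically. *)
Definition admissible_Phi (U : R -> R -> Prop) (Phi : R -> R -> R) : Prop :=
  solves_Phi_eq U Phi /\ exists a b, U a b /\ Phi11_ne Phi a b.

Definition admissible_F (J : R -> Prop) (F : R -> R) : Prop :=
  open J /\ smooth1 J F /\ forall s, J s -> Derive F s <> 0.

(* (a, b, c) stands for the values of (r^1, r^2, r^3) at (t, x). *)
Definition representation (Phi : R -> R -> R) (F : R -> R) (t x a b c : R)
  : Prop :=
     x - (a + b + 1) * t = Phi a b + D1 Phi a b
  /\ x - (a + b - 1) * t = Phi a b - D2 Phi a b
  /\ x - (a + b) * t = Phi a b + F c * exp (b - a).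

(* Around each point of Omega, (r1, r2, r3) satisfies the representation for
   some admissible Phi and F, which may depend on the point. *)
Definition locally_represented (Omega : R -> R -> Prop)
  (r1 r2 r3 : R -> R -> R) : Prop :=
  forall t0 x0, Omega t0 x0 ->
  exists (U : R -> R -> Prop) (Phi : R -> R -> R) (J : R -> Prop) (F : R -> R),
    admissible_Phi U Phi /\ admissible_F J F /\
    locally_2d (fun t x =>
      U (r1 t x) (r2 t x) /\ J (r3 t x) /\
      representation Phi F t x (r1 t x) (r2 t x) (r3 t x)) t0 x0.

(* The conclusion of the implicit function theorem at (t0, x0, a0, b0, c0):
   near this point, the set of all (t, x, a, b, c) obeying the representation
   is the graph of a smooth triple of functions of (t, x). *)
Definition determines_functions (U : R -> R -> Prop) (Phi : R -> R -> R)
  (J : R -> Prop) (F : R -> R) (t0 x0 a0 b0 c0 : R) : Prop :=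
  exists (Omega : R -> R -> Prop) (r1 r2 r3 : R -> R -> R) (eps : posreal),
    open2 Omega /\ Omega t0 x0 /\
    smooth2 Omega r1 /\ smooth2 Omega r2 /\ smooth2 Omega r3 /\
    r1 t0 x0 = a0 /\ r2 t0 x0 = b0 /\ r3 t0 x0 = c0 /\
    forall t x, Omega t x ->
      U (r1 t x) (r2 t x) /\ J (r3 t x) /\
      Rabs (r1 t x - a0) < eps /\ Rabs (r2 t x - b0) < eps /\
      Rabs (r3 t x - c0) < eps /\
      forall a b c, U a b -> J c ->
        Rabs (a - a0) < eps -> Rabs (b - b0) < eps -> Rabs (c - c0) < eps ->
        (representation Phi F t x a b c <->
         a = r1 t x /\ b = r2 t x /\ c = r3 t x).

(* Main.v *)
(* The first two equations of the system become linear under the hodograph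
   transformation: with t = T(a, b) and x = X(a, b) for (a, b) = (r^1, r^2), they
   read X_b = (a + b + 1) T_b and X_a = (a + b - 1) T_a.  Since
   exp(r^1 - r^2) / r^3_x is constant along the third characteristic field, it
   equals F'(r^3) for some function F, and with E = F(r^3) exp(b - a) the function
   Phi := X - (a + b) T - E satisfies Phi_1 = E - T and Phi_2 = - E - T, whence
   Phi_12 = E, Phi_11 + Phi_12 = - 2 T_1, and the representation.  Conversely,
   differentiating the representation along a curve and using
   Phi_2 + Phi_12 = Phi_1 - Phi_12 = - t separates it into
     dx - (a + b + 1) dt = (Phi_11 + Phi_12) da,
     dx - (a + b - 1) dt = - (Phi_22 + Phi_12) db,
     dx - (a + b) dt = F'(c) exp(b - a) dc.
   The two inequalities are equivalent because A = Phi_11 + Phi_12 and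
   B = Phi_22 + Phi_12 satisfy A_2 = B_1 = (A - B) / 2. *)

Require Import Defs.
From Stdlib Require Import Reals Lra Lia ClassicalEpsilon Ranalysis5.
From Coquelicot Require Import Coquelicot.
Open Scope R_scope.

(** * Calculus of functions of two variables *)

(** Admissibility makes A = Phi_11 + Phi_12 nonzero at some point only, whereas the map (a, b) ->
    (t, x) given by the first two equations has Jacobian A B / 2 and is inverted where both A and B
    are nonzero. For a given represented solution this holds at every point: along the x-direction
    the separated relations read 1 = A r^1_x and 1 = - B r^2_x. For a given Phi a common point has
    to be found: if B vanished wherever A does not, B_1 = (A - B) / 2 would force A to vanish there
    as well. For a given solution, (r^1, r^2) can be inverted because its Jacobian in (t, x) is - 2
    r^1_x r^2_x. The representation is triangular: c is absent from the first two equations and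
    enters the third through F(c) alone. Hence three unknowns reduce to inverse functions in two
    variables and in one, and both rest on one scalar implicit function theorem: the root exists by
    intermediate values, is unique by monotonicity, and is smooth because its derivatives are smooth
    expressions in the root itself. *)

Lemma open2_locally_1 (U : R -> R -> Prop) (x y : R) :
  open2 U -> U x y -> locally x (fun z => U z y).
Proof. intros HU Hx. apply (locally_2d_1d_const_y U), HU, Hx. Qed.

Lemma open2_locally_2 (U : R -> R -> Prop) (x y : R) :
  open2 U -> U x y -> locally y (fun z => U x z).
Proof. intros HU Hx. apply (locally_2d_1d_const_x U), HU, Hx. Qed.

Lemma D1_ext_on (U : R -> R -> Prop) (f g : R -> R -> R) :
  open2 U -> (forall x y, U x y -> f x y = g x y) ->
  forall x y, U x y -> D1 f x y = D1 g x y.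
Proof.
  intros HU Hfg x y Hx. apply Derive_ext_loc.
  generalize (open2_locally_1 U x y HU Hx). apply filter_imp. intros z Hz.
  now apply Hfg.
Qed.

Lemma D2_ext_on (U : R -> R -> Prop) (f g : R -> R -> R) :
  open2 U -> (forall x y, U x y -> f x y = g x y) ->
  forall x y, U x y -> D2 f x y = D2 g x y.
Proof.
  intros HU Hfg x y Hx. apply Derive_ext_loc.
  generalize (open2_locally_2 U x y HU Hx). apply filter_imp. intros z Hz.
  now apply Hfg.
Qed.

Lemma Ck_ext (n : nat) (U : R -> R -> Prop) (f g : R -> R -> R) :
  open2 U -> (forall x y, U x y -> f x y = g x y) -> Ck n U f -> Ck n U g.
Proof.
  intros HU. revert f g. induction n as [|n IH]; intros f g Hfg; simpl.
  - intros Hf x y Hx. apply continuity_2d_pt_ext_loc with f; [|now apply Hf].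
    generalize (HU x y Hx). apply locally_2d_impl, locally_2d_forall, Hfg.
  - intros [Hd [H1 H2]]. split; [|split].
    + intros x y Hx. destruct (Hd x y Hx) as [E1 E2]. split.
      * eapply ex_derive_ext_loc; [|exact E1].
        generalize (open2_locally_1 U x y HU Hx). apply filter_imp.
        intros z Hz. now apply Hfg.
      * eapply ex_derive_ext_loc; [|exact E2].
        generalize (open2_locally_2 U x y HU Hx). apply filter_imp.
        intros z Hz. now apply Hfg.
    + apply IH with (D1 f); [|easy]. now apply D1_ext_on.
    + apply IH with (D2 f); [|easy]. now apply D2_ext_on.
Qed.

Lemma Ck_subset (n : nat) (U V : R -> R -> Prop) (f : R -> R -> R) :
  (forall x y, V x y -> U x y) -> Ck n U f -> Ck n V f.
Proof.
  intros HVU. revert f. induction n as [|n IH]; intros f; simpl.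
  - intros Hf x y Hx. apply Hf, HVU, Hx.
  - intros [Hd [H1 H2]]. split; [|split]; auto.
Qed.

(** The increment splits into a horizontal part, controlled by continuity of [D1 f], and a vertical
    part on the line through [x], controlled by the derivative at [y]. *)
Lemma differentiable_of_partials (f : R -> R -> R) (x y : R) :
  locally_2d (fun u v => ex_derive (fun z => f z v) u) x y ->
  ex_derive (fun z => f x z) y -> continuity_2d_pt (D1 f) x y ->
  differentiable_pt_lim f x y (D1 f x y) (D2 f x y).
Proof.
  intros H1 H2 Hc. apply filterdiff_differentiable_pt_lim.
  apply (is_derive_filterdiff f x y (D1 f) (D2 f x y)).
  - apply locally_2d_locally in H1. revert H1. apply filter_imp.
    intros [u v] Hu. apply Derive_correct. exact Hu.
  - apply Derive_correct, H2.
  - apply continuity_2d_pt_filterlim, Hc.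
Qed.

Lemma Ck1_differentiable (U : R -> R -> Prop) (f : R -> R -> R) (x y : R) :
  open2 U -> Ck 1 U f -> U x y ->
  differentiable_pt_lim f x y (D1 f x y) (D2 f x y).
Proof.
  intros HU [Hd [H1 _]] Hx. apply differentiable_of_partials.
  - generalize (HU x y Hx). apply locally_2d_impl, locally_2d_forall.
    intros u v Hu. exact (proj1 (Hd u v Hu)).
  - exact (proj2 (Hd x y Hx)).
  - now apply H1.
Qed.

(** [Ck] states continuity at top order only; one order lower it comes from total
    differentiability. *)
Lemma Ck_pred (n : nat) (U : R -> R -> Prop) (f : R -> R -> R) :
  open2 U -> Ck (S n) U f -> Ck n U f.
Proof.
  intros HU. revert f. induction n as [|n IH]; intros f Hf.
  - intros x y Hx. apply differentiable_continuity_pt.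
    exists (D1 f x y), (D2 f x y). now apply Ck1_differentiable with U.
  - destruct Hf as [Hd [H1 H2]]. split; [exact Hd|]. auto.
Qed.

Lemma smooth2_differentiable (U : R -> R -> Prop) (f : R -> R -> R) (x y : R) :
  open2 U -> smooth2 U f -> U x y ->
  differentiable_pt_lim f x y (D1 f x y) (D2 f x y).
Proof. intros HU Hf. apply Ck1_differentiable; [exact HU|apply Hf]. Qed.

Lemma smooth2_continuous (U : R -> R -> Prop) (f : R -> R -> R) (x y : R) :
  smooth2 U f -> U x y -> continuity_2d_pt f x y.
Proof. intros Hf. exact (Hf 0%nat x y). Qed.

Lemma smooth2_D1 (U : R -> R -> Prop) (f : R -> R -> R) :
  smooth2 U f -> smooth2 U (D1 f).
Proof. intros Hf n. apply (Hf (S n)). Qed.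

Lemma smooth2_D2 (U : R -> R -> Prop) (f : R -> R -> R) :
  smooth2 U f -> smooth2 U (D2 f).
Proof. intros Hf n. apply (Hf (S n)). Qed.

Lemma smooth2_is_derive_1 (U : R -> R -> Prop) (f : R -> R -> R) (x y : R) :
  smooth2 U f -> U x y -> is_derive (fun z => f z y) x (D1 f x y).
Proof. intros Hf Hx. apply Derive_correct. exact (proj1 (proj1 (Hf 1%nat) x y Hx)). Qed.

Lemma smooth2_is_derive_2 (U : R -> R -> Prop) (f : R -> R -> R) (x y : R) :
  smooth2 U f -> U x y -> is_derive (fun z => f x z) y (D2 f x y).
Proof. intros Hf Hx. apply Derive_correct. exact (proj2 (proj1 (Hf 1%nat) x y Hx)). Qed.

Lemma is_derive_comp_2d (f : R -> R -> R) (p q : R -> R) (s l1 l2 lp lq : R) :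
  differentiable_pt_lim f (p s) (q s) l1 l2 ->
  is_derive p s lp -> is_derive q s lq ->
  is_derive (fun z => f (p z) (q z)) s (l1 * lp + l2 * lq).
Proof.
  intros Hf Hp Hq. apply is_derive_Reals.
  apply derivable_pt_lim_comp_2d; [exact Hf| |]; now apply is_derive_Reals.
Qed.

Lemma differentiable_is_derive_1 (f : R -> R -> R) (x y l1 l2 : R) :
  differentiable_pt_lim f x y l1 l2 -> is_derive (fun z => f z y) x l1.
Proof.
  intros Hf. replace l1 with (l1 * 1 + l2 * 0) by ring.
  apply (is_derive_comp_2d f (fun z => z) (fun _ => y)); [exact Hf| |].
  - apply (is_derive_id x).
  - apply (is_derive_const y x).
Qed.

Lemma differentiable_is_derive_2 (f : R -> R -> R) (x y l1 l2 : R) :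
  differentiable_pt_lim f x y l1 l2 -> is_derive (fun z => f x z) y l2.
Proof.
  intros Hf. replace l2 with (l1 * 0 + l2 * 1) by ring.
  apply (is_derive_comp_2d f (fun _ => x) (fun z => z)); [exact Hf| |].
  - apply (is_derive_const x y).
  - apply (is_derive_id y).
Qed.

(** Replaces [D1 f] and [D2 f] by explicit formulas valid on [U], so that inductions on the order
    can work on these formulas. *)
Lemma Ck_S_intro (n : nat) (U : R -> R -> Prop) (f g1 g2 : R -> R -> R) :
  open2 U ->
  (forall x y, U x y -> is_derive (fun z => f z y) x (g1 x y)) ->
  (forall x y, U x y -> is_derive (fun z => f x z) y (g2 x y)) ->
  Ck n U g1 -> Ck n U g2 -> Ck (S n) U f.
Proof.
  intros HU H1 H2 C1 C2. split; [|split].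
  - intros x y Hx. split; [exists (g1 x y)|exists (g2 x y)]; auto.
  - apply Ck_ext with g1; [exact HU| |exact C1].
    intros x y Hx. symmetry. now apply is_derive_unique, H1.
  - apply Ck_ext with g2; [exact HU| |exact C2].
    intros x y Hx. symmetry. now apply is_derive_unique, H2.
Qed.

(** * Closure of the classes C^n under algebra and composition *)

Lemma Ck_const (n : nat) (U : R -> R -> Prop) (c : R) :
  open2 U -> Ck n U (fun _ _ => c).
Proof.
  intros HU. revert c. induction n as [|n IH]; intros c.
  - intros x y _. apply continuity_2d_pt_const.
  - apply Ck_S_intro with (fun _ _ => 0) (fun _ _ => 0); auto;
      intros x y _; apply @is_derive_const.
Qed.

Lemma smooth2_fst (U : R -> R -> Prop) : open2 U -> smooth2 U (fun x _ => x).
Proof.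
  intros HU [|n].
  - intros x y _. apply continuity_2d_pt_id1.
  - apply Ck_S_intro with (fun _ _ => 1) (fun _ _ => 0); auto using Ck_const;
      intros x y _; [apply (is_derive_id x)|apply (is_derive_const x y)].
Qed.

Lemma smooth2_snd (U : R -> R -> Prop) : open2 U -> smooth2 U (fun _ y => y).
Proof.
  intros HU [|n].
  - intros x y _. apply continuity_2d_pt_id2.
  - apply Ck_S_intro with (fun _ _ => 0) (fun _ _ => 1); auto using Ck_const;
      intros x y _; [apply (is_derive_const y x)|apply (is_derive_id y)].
Qed.

Lemma Ck_plus (n : nat) (U : R -> R -> Prop) (f g : R -> R -> R) :
  open2 U -> Ck n U f -> Ck n U g -> Ck n U (fun x y => f x y + g x y).
Proof.
  intros HU. revert f g. induction n as [|n IH]; intros f g Hf Hg.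
  - intros x y Hx. apply continuity_2d_pt_plus; [now apply Hf|now apply Hg].
  - destruct Hf as [Hfd [Hf1 Hf2]]. destruct Hg as [Hgd [Hg1 Hg2]].
    apply Ck_S_intro with (fun x y => D1 f x y + D1 g x y)
                          (fun x y => D2 f x y + D2 g x y); auto;
      intros x y Hx; apply @is_derive_plus; apply Derive_correct;
      destruct (Hfd x y Hx), (Hgd x y Hx); assumption.
Qed.

Lemma Ck_mult (n : nat) (U : R -> R -> Prop) (f g : R -> R -> R) :
  open2 U -> Ck n U f -> Ck n U g -> Ck n U (fun x y => f x y * g x y).
Proof.
  intros HU. revert f g. induction n as [|n IH]; intros f g Hf Hg.
  - intros x y Hx. apply continuity_2d_pt_mult; [now apply Hf|now apply Hg].
  - pose proof (Ck_pred n U f HU Hf) as Hf0.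
    pose proof (Ck_pred n U g HU Hg) as Hg0.
    destruct Hf as [Hfd [Hf1 Hf2]]. destruct Hg as [Hgd [Hg1 Hg2]].
    apply Ck_S_intro with (fun x y => D1 f x y * g x y + f x y * D1 g x y)
                          (fun x y => D2 f x y * g x y + f x y * D2 g x y);
      auto using Ck_plus; intros x y Hx;
      destruct (Hfd x y Hx) as [Ef1 Ef2]; destruct (Hgd x y Hx) as [Eg1 Eg2].
    + apply (is_derive_mult (fun z => f z y) (fun z => g z y) x (D1 f x y) (D1 g x y));
        [exact (Derive_correct _ _ Ef1)|exact (Derive_correct _ _ Eg1)|exact Rmult_comm].
    + apply (is_derive_mult (fun z => f x z) (fun z => g x z) y (D2 f x y) (D2 g x y));
        [exact (Derive_correct _ _ Ef2)|exact (Derive_correct _ _ Eg2)|exact Rmult_comm].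
Qed.

(** The outer function is smooth while the inner ones are only C^n: this is the form in which an
    implicit function gains one order of smoothness at a time. The induction varies [f], since the
    chain rule replaces it by its partial derivatives. *)
Lemma Ck_comp (n : nat) (U V : R -> R -> Prop) (f p q : R -> R -> R) :
  open2 U -> open2 V -> smooth2 U f -> (forall x y, V x y -> U (p x y) (q x y)) ->
  Ck n V p -> Ck n V q -> Ck n V (fun x y => f (p x y) (q x y)).
Proof.
  intros HU HV Hf HVU. revert f Hf. induction n as [|n IH]; intros f Hf Hp Hq.
  - intros x y Hx. apply continuity_2d_pt_filterlim.
    pose proof (smooth2_continuous U f _ _ Hf (HVU x y Hx)) as C.
    apply continuity_2d_pt_filterlim in C.
    apply (filterlim_comp_2 (F := locally (x, y))
      (fun z : R * R => p (fst z) (snd z)) (fun z : R * R => q (fst z) (snd z)) f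
      (G := locally (p x y)) (H := locally (q x y))).
    + apply continuity_2d_pt_filterlim. now apply Hp.
    + apply continuity_2d_pt_filterlim. now apply Hq.
    (* A neighbourhood of the pair contains a product of balls, which is what the product filter
       asks for. *)
    + intros P HP. specialize (C P HP).
      destruct C as [e He]. exists (fun u => ball (p x y) e u) (fun v => ball (q x y) e v).
      * now exists e.
      * now exists e.
      * intros u v Hu Hv. apply (He (u, v)). now split.
  - pose proof (Ck_pred n V p HV Hp) as Hp0.
    pose proof (Ck_pred n V q HV Hq) as Hq0.
    destruct Hp as [Hpd [Hp1 Hp2]]. destruct Hq as [Hqd [Hq1 Hq2]].
    pose proof (smooth2_D1 U f Hf) as Hf1. pose proof (smooth2_D2 U f Hf) as Hf2.
    apply Ck_S_intro with
      (fun x y => D1 f (p x y) (q x y) * D1 p x y + D2 f (p x y) (q x y) * D1 q x y)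
      (fun x y => D1 f (p x y) (q x y) * D2 p x y + D2 f (p x y) (q x y) * D2 q x y).
    + exact HV.
    + intros x y Hx.
      destruct (Hpd x y Hx) as [Ep _]. destruct (Hqd x y Hx) as [Eq _].
      apply (is_derive_comp_2d f (fun z => p z y) (fun z => q z y)).
      * apply smooth2_differentiable with U; auto.
      * exact (Derive_correct _ _ Ep).
      * exact (Derive_correct _ _ Eq).
    + intros x y Hx.
      destruct (Hpd x y Hx) as [_ Ep]. destruct (Hqd x y Hx) as [_ Eq].
      apply (is_derive_comp_2d f (fun z => p x z) (fun z => q x z)).
      * apply smooth2_differentiable with U; auto.
      * exact (Derive_correct _ _ Ep).
      * exact (Derive_correct _ _ Eq).
    + apply Ck_plus; auto; apply Ck_mult; auto.
    + apply Ck_plus; auto; apply Ck_mult; auto.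
Qed.

Lemma smooth2_ext (U : R -> R -> Prop) (f g : R -> R -> R) :
  open2 U -> (forall x y, U x y -> f x y = g x y) -> smooth2 U f -> smooth2 U g.
Proof. intros HU Hfg Hf n. now apply Ck_ext with f. Qed.

Lemma smooth2_subset (U V : R -> R -> Prop) (f : R -> R -> R) :
  (forall x y, V x y -> U x y) -> smooth2 U f -> smooth2 V f.
Proof. intros HVU Hf n. now apply Ck_subset with U. Qed.

Lemma smooth2_const (U : R -> R -> Prop) (c : R) :
  open2 U -> smooth2 U (fun _ _ => c).
Proof. intros HU n. now apply Ck_const. Qed.

Lemma smooth2_plus (U : R -> R -> Prop) (f g : R -> R -> R) :
  open2 U -> smooth2 U f -> smooth2 U g -> smooth2 U (fun x y => f x y + g x y).
Proof. intros HU Hf Hg n. now apply Ck_plus. Qed.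

Lemma smooth2_mult (U : R -> R -> Prop) (f g : R -> R -> R) :
  open2 U -> smooth2 U f -> smooth2 U g -> smooth2 U (fun x y => f x y * g x y).
Proof. intros HU Hf Hg n. now apply Ck_mult. Qed.

Lemma smooth2_opp (U : R -> R -> Prop) (f : R -> R -> R) :
  open2 U -> smooth2 U f -> smooth2 U (fun x y => - f x y).
Proof.
  intros HU Hf. apply smooth2_ext with (fun x y => (-1) * f x y); auto.
  - intros; ring.
  - apply smooth2_mult; auto using smooth2_const.
Qed.

Lemma smooth2_minus (U : R -> R -> Prop) (f g : R -> R -> R) :
  open2 U -> smooth2 U f -> smooth2 U g -> smooth2 U (fun x y => f x y - g x y).
Proof. intros HU Hf Hg. apply smooth2_plus; auto using smooth2_opp. Qed.

Lemma smooth2_comp (U V : R -> R -> Prop) (f p q : R -> R -> R) :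
  open2 U -> open2 V -> smooth2 U f -> (forall x y, V x y -> U (p x y) (q x y)) ->
  smooth2 V p -> smooth2 V q -> smooth2 V (fun x y => f (p x y) (q x y)).
Proof. intros HU HV Hf HVU Hp Hq n. now apply Ck_comp with U. Qed.

Lemma smooth1_Derive (J : R -> Prop) (F : R -> R) :
  smooth1 J F -> smooth1 J (Derive F).
Proof.
  intros HF [|n] s Hs; [easy|]. generalize (HF (S (S n)) s Hs).
  apply ex_derive_ext. intros z. change (Derive_n F (S n) z = Derive_n (Derive F) n z).
  rewrite <- (Nat.add_1_r n). symmetry. apply (Derive_n_comp F n 1).
Qed.

Lemma open2_snd (J : R -> Prop) : open J -> open2 (fun _ v => J v).
Proof.
  intros HJ x y Hy. destruct (HJ y Hy) as [e He]. exists e.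
  intros u v _ Hv. apply He, Hv.
Qed.

(** Embeds functions of one variable as functions of the second variable, the one solved for in the
    scalar implicit function theorem; composition and inversion then need no separate one-variable
    theory. *)
Lemma smooth1_smooth2_snd (J : R -> Prop) (F : R -> R) :
  open J -> smooth1 J F -> smooth2 (fun _ v => J v) (fun _ v => F v).
Proof.
  intros HJ HF n. revert F HF. induction n as [|n IH]; intros F HF.
  - intros x y Hy. apply (continuity_1d_2d_pt_comp F (fun _ v => v)).
    + apply continuity_pt_filterlim, (ex_derive_continuous F y).
      exact (HF 1%nat y Hy).
    + apply continuity_2d_pt_id2.
  - apply Ck_S_intro with (fun _ _ => 0) (fun _ v => Derive F v).
    + now apply open2_snd.
    + intros x y _. apply @is_derive_const.
    + intros x y Hy. apply Derive_correct. exact (HF 1%nat y Hy).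
    + now apply Ck_const, open2_snd.
    + now apply IH, smooth1_Derive.
Qed.

Lemma smooth2_snd_smooth1 (J : R -> Prop) (U : R -> R -> Prop)
  (f : R -> R -> R) (t0 : R) :
  smooth2 U f -> (forall s, J s -> U t0 s) -> open J ->
  smooth1 J (fun s => f t0 s).
Proof.
  intros Hf HJU HJ.
  assert (E : forall n s, Derive_n (fun s => f t0 s) n s = Nat.iter n D2 f t0 s).
  { induction n as [|n IH]; intros s; [easy|].
    simpl. unfold D2 at 1. apply Derive_ext, IH. }
  assert (Sm : forall n, smooth2 U (Nat.iter n D2 f)).
  { induction n as [|n IH]; [exact Hf|]. now apply smooth2_D2. }
  intros [|n] s Hs; [easy|]. simpl.
  apply ex_derive_ext with (fun s => Nat.iter n D2 f t0 s).
  - intros z. now rewrite E.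
  - exists (D2 (Nat.iter n D2 f) t0 s).
    apply smooth2_is_derive_2 with U; auto.
Qed.

Lemma smooth2_comp1 (J : R -> Prop) (V : R -> R -> Prop) (F : R -> R)
  (p : R -> R -> R) :
  open J -> open2 V -> smooth1 J F -> (forall x y, V x y -> J (p x y)) ->
  smooth2 V p -> smooth2 V (fun x y => F (p x y)).
Proof.
  intros HJ HV HF HVJ Hp.
  apply (smooth2_comp (fun _ v => J v) V (fun _ v => F v) p p); auto.
  - now apply open2_snd.
  - now apply smooth1_smooth2_snd.
Qed.

Lemma smooth2_exp (V : R -> R -> Prop) (p : R -> R -> R) :
  open2 V -> smooth2 V p -> smooth2 V (fun x y => exp (p x y)).
Proof.
  intros HV. apply (smooth2_comp1 (fun _ => True)); auto.
  - apply open_true.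
  - assert (E : forall n s, Derive_n exp n s = exp s).
    { induction n as [|n IH]; intros s; [easy|]. simpl.
      rewrite (Derive_ext _ exp); [|exact IH].
      apply is_derive_unique, is_derive_exp. }
    intros [|n] s _; [easy|]. simpl. apply ex_derive_ext with exp; [easy|].
    exists (exp s). apply is_derive_exp.
Qed.

(** The derivative of [/ v] is minus its own square, so the induction on the order closes on
    products. *)
Lemma smooth2_inv (V : R -> R -> Prop) (p : R -> R -> R) :
  open2 V -> (forall x y, V x y -> p x y <> 0) -> smooth2 V p ->
  smooth2 V (fun x y => / p x y).
Proof.
  intros HV Hp0 Hp.
  assert (O : open2 (fun _ v => v <> 0)) by apply open2_snd, open_neq.
  apply (smooth2_comp (fun _ v => v <> 0) V (fun _ v => / v) p p); auto.
  intros n. induction n as [|n IH].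
  - intros x y Hy. apply continuity_2d_pt_inv; [apply continuity_2d_pt_id2|easy].
  - apply Ck_S_intro with (fun _ _ => 0) (fun _ v => (-1) * (/ v * / v)); auto.
    + intros x y _. apply @is_derive_const.
    + intros x y Hy. auto_derive; [easy|]. now field.
    + now apply Ck_const.
    + apply Ck_mult; auto using Ck_const, Ck_mult.
Qed.

Lemma smooth2_Schwarz (U : R -> R -> Prop) (f : R -> R -> R) (x y : R) :
  open2 U -> smooth2 U f -> U x y -> D1 (D2 f) x y = D2 (D1 f) x y.
Proof.
  intros HU Hf Hx. unfold D1, D2. apply Schwarz.
  - generalize (HU x y Hx). apply locally_2d_impl, locally_2d_forall.
    intros u v Hu. repeat split.
    + exact (proj1 (proj1 (Hf 1%nat) u v Hu)).
    + exact (proj2 (proj1 (Hf 1%nat) u v Hu)).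
    + exact (proj1 (proj1 (smooth2_D2 U f Hf 1%nat) u v Hu)).
    + exact (proj2 (proj1 (smooth2_D1 U f Hf 1%nat) u v Hu)).
  - apply (smooth2_continuous U (D1 (D2 f))); auto using smooth2_D1, smooth2_D2.
  - apply (smooth2_continuous U (D2 (D1 f))); auto using smooth2_D1, smooth2_D2.
Qed.

(** * Implicit and inverse functions *)

Definition box (x0 y0 e : R) (x y : R) : Prop :=
  Rabs (x - x0) < e /\ Rabs (y - y0) < e.

Lemma open2_and (U V : R -> R -> Prop) :
  open2 U -> open2 V -> open2 (fun x y => U x y /\ V x y).
Proof. intros HU HV x y [Hx Hy]. apply locally_2d_and; auto. Qed.

Lemma open2_preimage (V : R -> R -> Prop) (J : R -> Prop) (p : R -> R -> R) :
  open2 V -> (forall x y, V x y -> continuity_2d_pt p x y) -> open J ->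
  open2 (fun x y => V x y /\ J (p x y)).
Proof.
  intros HV Hp HJ x y [Hx Hy]. apply locally_2d_and; [now apply HV|].
  destruct (HJ _ Hy) as [e He]. generalize (Hp x y Hx e).
  apply locally_2d_impl, locally_2d_forall. intros u v Huv. apply He, Huv.
Qed.

Lemma open_ball_R (x0 e : R) : open (fun x => Rabs (x - x0) < e).
Proof.
  intros x Hx. assert (He : 0 < e - Rabs (x - x0)) by lra.
  exists (mkposreal _ He). intros y Hy.
  assert (Hy' : Rabs (y - x) < e - Rabs (x - x0)) by exact Hy.
  replace (y - x0) with ((y - x) + (x - x0)) by ring.
  eapply Rle_lt_trans; [apply Rabs_triang|lra].
Qed.

Lemma open2_fst (J : R -> Prop) : open J -> open2 (fun x _ => J x).
Proof.
  intros HJ x y Hx. destruct (HJ x Hx) as [e He]. exists e.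
  intros u v Hu _. apply He, Hu.
Qed.

Lemma open2_box (x0 y0 e : R) : open2 (box x0 y0 e).
Proof.
  apply open2_and; [apply (open2_fst _ (open_ball_R x0 e))
                   |apply (open2_snd _ (open_ball_R y0 e))].
Qed.

Lemma box_center (x0 y0 : R) (e : posreal) : box x0 y0 e x0 y0.
Proof.
  split; rewrite Rminus_diag, Rabs_R0; apply cond_pos.
Qed.

Lemma locally_2d_box (P : R -> R -> Prop) (x0 y0 : R) :
  locally_2d P x0 y0 <-> exists e : posreal, forall x y, box x0 y0 e x y -> P x y.
Proof.
  split; intros [e He]; exists e; [intros x y [Hx Hy]; auto|].
  intros x y Hx Hy. apply He. now split.
Qed.

Lemma open2_pos (V : R -> R -> Prop) (p : R -> R -> R) :
  open2 V -> smooth2 V p -> open2 (fun x y => V x y /\ 0 < p x y).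
Proof.
  intros HV Hp. apply (open2_preimage V (fun s => 0 < s)); [exact HV| |apply open_gt].
  intros x y. now apply smooth2_continuous.
Qed.

(** Since [f u (g u w) = w] exactly, the linear approximation of [f] can be solved for the increment
    of [g]. Its error is measured with that same increment, so a Lipschitz bound for [g] comes
    before the sharp estimate. *)
Lemma differentiable_implicit (f g : R -> R -> R) (u1 w1 fu fv : R) :
  differentiable_pt_lim f u1 (g u1 w1) fu fv -> fv <> 0 ->
  continuity_2d_pt g u1 w1 ->
  locally_2d (fun u w => f u (g u w) = w) u1 w1 ->
  differentiable_pt_lim g u1 w1 (- fu * / fv) (/ fv).
Proof.
  intros Hf Hfv Hg Hfg eps.
  set (m := Rabs fv). assert (Hm : 0 < m) by now apply Rabs_pos_lt.
  (* [C] is the Lipschitz constant of [Hv]: moving an error of at most [m / 2 * Rabs dv] to the left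
     leaves [m / 2 * Rabs dv <= (1 + Rabs fu + m / 2) * M]. *)
  set (C := 2 * (1 + Rabs fu + m / 2) / m).
  pose proof (Rabs_pos fu) as Hfu. pose proof (cond_pos eps) as Heps.
  assert (HC : 0 < C).
  { unfold C. apply Rdiv_lt_0_compat; lra. }
  assert (HCm : C * m = 2 * (1 + Rabs fu + m / 2)) by (unfold C; field; lra).
  (* The bound [m / 2] permits this absorption; the other makes the final error at most [eps * M]
     after division by [m], because [Rabs du + Rabs dv <= (1 + C) * M]. *)
  set (e1 := Rmin (m / 2) (eps * m / (1 + C))).
  assert (He1 : 0 < e1).
  { unfold e1. apply Rmin_pos; [lra|]. apply Rdiv_lt_0_compat; nra. }
  assert (He1m : e1 <= m / 2) by apply Rmin_l.
  assert (He1C : e1 * (1 + C) <= eps * m).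
  { apply Rle_trans with (eps * m / (1 + C) * (1 + C)).
    - apply Rmult_le_compat_r; [lra|apply Rmin_r].
    - right. field. lra. }
  destruct (Hf (mkposreal e1 He1)) as [d Hd]. simpl in Hd.
  pose proof (locally_2d_singleton _ _ _ Hfg) as E0. simpl in E0.
  assert (L : locally_2d (fun u w => Rabs (u - u1) < d) u1 w1).
  { exists d. now intros u v Hu _. }
  generalize (locally_2d_and _ _ _ _ L (locally_2d_and _ _ _ _ Hfg (Hg d))).
  apply locally_2d_impl, locally_2d_forall. intros u w [Hu [E Hgw]].
  specialize (Hd u (g u w) Hu Hgw). rewrite E, E0 in Hd.
  set (du := u - u1) in *. set (dw := w - w1) in *.
  set (dv := g u w - g u1 w1) in *.
  pose proof (Rabs_pos du). pose proof (Rabs_pos dv). pose proof (Rabs_pos dw).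
  set (M := Rmax (Rabs du) (Rabs dw)).
  assert (HMu : Rabs du <= M) by apply Rmax_l.
  assert (HMw : Rabs dw <= M) by apply Rmax_r.
  assert (Hmax : Rmax (Rabs du) (Rabs dv) <= Rabs du + Rabs dv).
  { apply Rmax_lub; lra. }
  assert (Hd' : Rabs (dw - (fu * du + fv * dv)) <= e1 * (Rabs du + Rabs dv)).
  { eapply Rle_trans; [exact Hd|]. apply Rmult_le_compat_l; lra. }
  assert (Hv : Rabs dv <= C * M).
  { assert (T : m * Rabs dv <= Rabs dw + Rabs fu * Rabs du + e1 * (Rabs du + Rabs dv)).
    { unfold m. rewrite <- !Rabs_mult.
      replace (fv * dv) with (dw + - (fu * du) + - (dw - (fu * du + fv * dv))) by ring.
      eapply Rle_trans; [apply Rabs_triang|]. rewrite Rabs_Ropp.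
      apply Rplus_le_compat; [|exact Hd'].
      eapply Rle_trans; [apply Rabs_triang|]. rewrite Rabs_Ropp. lra. }
    apply Rmult_le_reg_r with m; [exact Hm|].
    replace (C * M * m) with (C * m * M) by ring. rewrite HCm. nra. }
  replace (dv - (- fu * / fv * du + / fv * dw))
    with (- (dw - (fu * du + fv * dv)) * / fv) by (field; exact Hfv).
  rewrite Rabs_mult, Rabs_Ropp, Rabs_inv. fold m.
  apply Rmult_le_reg_r with m; [exact Hm|].
  rewrite Rmult_assoc, Rinv_l, Rmult_1_r by lra.
  eapply Rle_trans; [exact Hd'|].
  apply Rle_trans with (e1 * (1 + C) * M).
  - rewrite Rmult_assoc. apply Rmult_le_compat_l; lra.
  - rewrite (Rmult_comm _ m), <- Rmult_assoc, (Rmult_comm m).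
    apply Rmult_le_compat_r; lra.
Qed.

(** The level [w] is kept as a second parameter of [g]. This makes one statement serve for implicit
    functions, for changes of coordinates and for inverse functions. *)
Lemma implicit_function_scalar (U : R -> R -> Prop) (f : R -> R -> R) (u0 v0 : R) :
  open2 U -> smooth2 U f -> U u0 v0 -> D2 f u0 v0 <> 0 ->
  exists (e : posreal) (W : R -> R -> Prop) (g : R -> R -> R),
    open2 W /\ W u0 (f u0 v0) /\ smooth2 W g /\
    (forall u w, W u w -> box u0 v0 e u (g u w) /\ f u (g u w) = w /\
       D1 g u w = - D1 f u (g u w) * / D2 f u (g u w) /\
       D2 g u w = / D2 f u (g u w)) /\
    (forall u v, box u0 v0 e u v -> U u v /\ D2 f u v <> 0) /\
    (forall u v v', box u0 v0 e u v -> box u0 v0 e u v' -> f u v = f u v' -> v = v').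
Proof.
  intros HU Hf H0 Hk. set (k := D2 f u0 v0) in *.
  (* The factor [k] treats both signs of the derivative at once: [k * f u v] increases with [v] on
     the box. *)
  assert (L : locally_2d (fun u v => U u v /\ 0 < k * D2 f u v) u0 v0).
  { apply (open2_pos U (fun u v => k * D2 f u v)).
    - exact HU.
    - apply smooth2_mult; auto using smooth2_const, smooth2_D2.
    - split; [exact H0|]. fold k. nra. }
  apply locally_2d_box in L. destruct L as [e He].
  assert (Mono : forall u v v', box u0 v0 e u v -> box u0 v0 e u v' -> v < v' ->
    0 < k * (f u v' - f u v)).
  { intros u v v' [Hu Hv] [_ Hv'] Hlt.
    assert (In : forall x, Rmin v v' <= x <= Rmax v v' -> box u0 v0 e u x).
    { intros x. rewrite Rmin_left, Rmax_right by lra. intros Hx. split; [exact Hu|].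
      apply Rabs_def2 in Hv. apply Rabs_def2 in Hv'. apply Rabs_def1; lra. }
    destruct (MVT_gen (f u) v v' (D2 f u)) as [c [Hc E]].
    - intros x Hx. apply (smooth2_is_derive_2 U); [exact Hf|].
      apply He, In. lra.
    - intros x Hx. apply continuity_pt_filterlim, (ex_derive_continuous (f u)).
      eexists. apply (smooth2_is_derive_2 U); [exact Hf|]. now apply He, In.
    - rewrite E, <- Rmult_assoc. apply Rmult_lt_0_compat; [|lra].
      now apply He, In. }
  assert (Inj : forall u v v',
    box u0 v0 e u v -> box u0 v0 e u v' -> f u v = f u v' -> v = v').
  { intros u v v' Hv Hv' E.
    destruct (Rtotal_order v v') as [Hlt|[Heq|Hgt]]; [|exact Heq|].
    - pose proof (Mono u v v' Hv Hv' Hlt). nra.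
    - pose proof (Mono u v' v Hv' Hv Hgt). nra. }
  set (h := e / 2). pose proof (cond_pos e) as Hepos.
  assert (Hbox : forall u d, Rabs (u - u0) < e -> Rabs d < e -> box u0 v0 e u (v0 + d)).
  { intros u d Hu Hd. split; [exact Hu|]. now replace (v0 + d - v0) with d by ring. }
  assert (Hh : Rabs h < e) by (unfold h; rewrite Rabs_pos_eq; lra).
  assert (Hh' : Rabs (- h) < e) by now rewrite Rabs_Ropp.
  assert (Sm : forall d, Rabs d < e ->
    smooth2 (fun u _ => Rabs (u - u0) < e) (fun u _ => f u (v0 + d))).
  { intros d Hd.
    pose proof (open2_fst _ (open_ball_R u0 e)) as O.
    apply (smooth2_comp U _ f (fun u _ => u) (fun _ _ => v0 + d));
      auto using smooth2_fst, smooth2_const.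
    intros u v Hu. now apply He, Hbox. }
  (* The levels strictly between the values of [f u] at [v0 - h] and [v0 + h]: an open condition
     that gives the sign change for the intermediate value theorem. With [h] half of [e], both ends
     lie in the open box. *)
  set (W := fun u w => (Rabs (u - u0) < e /\ 0 < k * (f u (v0 + h) - w))
                       /\ 0 < k * (w - f u (v0 + - h))).
  assert (OW : open2 W).
  { pose proof (open2_fst _ (open_ball_R u0 e)) as O.
    assert (O1 : open2 (fun u w => Rabs (u - u0) < e /\ 0 < k * (f u (v0 + h) - w))).
    { apply (open2_pos _ (fun u w => k * (f u (v0 + h) - w)) O).
      apply smooth2_mult; auto using smooth2_const.
      apply (smooth2_minus _ (fun u _ => f u (v0 + h))); auto using smooth2_snd. }
    apply (open2_pos _ (fun u w => k * (w - f u (v0 + - h))) O1).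
    apply smooth2_mult; auto using smooth2_const.
    apply (smooth2_minus _ (fun _ w => w) (fun u _ => f u (v0 + - h)));
      auto using smooth2_snd.
    apply smooth2_subset with (2 := Sm (- h) Hh'). now intros u w [Hu _]. }
  assert (Hu0 : Rabs (u0 - u0) < e) by (rewrite Rminus_diag, Rabs_R0; exact Hepos).
  assert (W0 : W u0 (f u0 v0)).
  { repeat split; [exact Hu0| |]; apply Mono; auto using box_center;
      unfold h; lra. }
  assert (Ex : forall u w, W u w -> exists v, box u0 v0 e u v /\ f u v = w).
  { intros u w [[Hu H1] H2].
    assert (In : forall a, v0 + - h <= a <= v0 + h -> box u0 v0 e u a).
    { intros a Ha. replace a with (v0 + (a - v0)) by ring. apply Hbox; [exact Hu|].
      unfold h in Ha. apply Rabs_def1; lra. }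
    destruct (IVT_interv (fun v => k * (f u v - w)) (v0 + - h) (v0 + h)) as [z [Hz E]].
    - intros a Ha. apply continuity_pt_mult; [now apply continuity_pt_const|].
      apply continuity_pt_minus; [|now apply continuity_pt_const].
      apply continuity_pt_filterlim, (ex_derive_continuous (f u)).
      eexists. apply (smooth2_is_derive_2 U); [exact Hf|]. now apply He, In.
    - unfold h. lra.
    - lra.
    - exact H1.
    - exists z. split; [now apply In|].
      apply Rmult_integral in E. lra. }
  set (g := fun u w => epsilon (inhabits 0) (fun v => box u0 v0 e u v /\ f u v = w)).
  assert (Hg : forall u w, W u w -> box u0 v0 e u (g u w) /\ f u (g u w) = w).
  { intros u w Hw. unfold g. now apply epsilon_spec, Ex. }
  assert (Cont : forall u w, W u w -> continuity_2d_pt g u w).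
  { intros u1 w1 Hw1 eps. destruct (Hg u1 w1 Hw1) as [[Hu1 Hv1] E1].
    set (v1 := g u1 w1) in *.
    (* The root is trapped between [v1 - d] and [v1 + d]: that the level lies strictly between the
       values of [f u] there is an open condition on [(u, w)], and monotonicity carries it over to
       the root. Halving the minimum keeps both ends in the box. *)
    set (d := Rmin eps (e - Rabs (v1 - v0)) / 2).
    assert (Hm : 0 < Rmin eps (e - Rabs (v1 - v0))).
    { apply Rmin_pos; [apply cond_pos|lra]. }
    pose proof (Rmin_l eps (e - Rabs (v1 - v0))) as Hm1.
    pose proof (Rmin_r eps (e - Rabs (v1 - v0))) as Hm2.
    assert (Hd : 0 < d) by (unfold d; lra).
    assert (Hde : d < eps) by (unfold d; lra).
    assert (Hbd : forall s, Rabs s <= d -> Rabs (v1 - v0 + s) < e).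
    { intros s Hs. eapply Rle_lt_trans; [apply Rabs_triang|]. unfold d in Hs. lra. }
    assert (B1 : Rabs (v1 - v0 + d) < e) by (apply Hbd; rewrite Rabs_pos_eq; lra).
    assert (B2 : Rabs (v1 - v0 + - d) < e)
      by (apply Hbd; rewrite Rabs_Ropp, Rabs_pos_eq; lra).
    pose proof (open2_fst _ (open_ball_R u0 e)) as O.
    assert (L1 : locally_2d (fun u w => Rabs (u - u0) < e /\
        0 < k * (f u (v0 + (v1 - v0 + d)) - w)) u1 w1).
    { apply (open2_pos _ (fun u w => k * (f u (v0 + (v1 - v0 + d)) - w)) O).
      - apply smooth2_mult; auto using smooth2_const.
        apply (smooth2_minus _ (fun u _ => f u (v0 + (v1 - v0 + d))));
          auto using smooth2_snd.
      - split; [exact Hu1|]. rewrite <- E1. apply Mono; [now split|now apply Hbox|lra]. }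
    assert (L2 : locally_2d (fun u w => Rabs (u - u0) < e /\
        0 < k * (w - f u (v0 + (v1 - v0 + - d)))) u1 w1).
    { apply (open2_pos _ (fun u w => k * (w - f u (v0 + (v1 - v0 + - d)))) O).
      - apply smooth2_mult; auto using smooth2_const.
        apply (smooth2_minus _ (fun _ w => w) (fun u _ => f u (v0 + (v1 - v0 + - d))));
          auto using smooth2_snd.
      - split; [exact Hu1|]. rewrite <- E1 at 1.
        apply Mono; [now apply Hbox|now split|lra]. }
    generalize (locally_2d_and _ _ _ _ (OW u1 w1 Hw1) (locally_2d_and _ _ _ _ L1 L2)).
    apply locally_2d_impl, locally_2d_forall. intros u w [Hw [[Hu P1] [_ P2]]].
    destruct (Hg u w Hw) as [Hb E]. set (v := g u w) in *.
    assert (v < v1 + d).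
    { destruct (Rlt_or_le v (v1 + d)) as [Hlt|[Hlt|Heq]]; [exact Hlt| |].
      - assert (0 < k * (f u v - f u (v0 + (v1 - v0 + d)))).
        { apply Mono; [now apply Hbox|exact Hb|lra]. }
        rewrite E in *. lra.
      - replace (v0 + (v1 - v0 + d)) with v in P1 by lra. rewrite E in P1. lra. }
    assert (v1 - d < v).
    { destruct (Rlt_or_le (v1 - d) v) as [Hlt|[Hlt|Heq]]; [exact Hlt| |].
      - assert (0 < k * (f u (v0 + (v1 - v0 + - d)) - f u v)).
        { apply Mono; [exact Hb|now apply Hbox|lra]. }
        rewrite E in *. lra.
      - replace (v0 + (v1 - v0 + - d)) with v in P2 by lra. rewrite E in P2. lra. }
    apply Rabs_def1; lra. }
  assert (Diff : forall u w, W u w -> differentiable_pt_lim g u w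
      (- D1 f u (g u w) * / D2 f u (g u w)) (/ D2 f u (g u w))).
  { intros u w Hw. destruct (Hg u w Hw) as [Hb E]. destruct (He _ _ Hb) as [HUv Hpos].
    apply differentiable_implicit with f; auto.
    - now apply smooth2_differentiable with U.
    - intros Z. rewrite Z in Hpos. lra.
    - generalize (OW u w Hw). apply locally_2d_impl, locally_2d_forall.
      intros u' w' Hw'. now apply Hg. }
  assert (Hne : forall u v, box u0 v0 e u v -> D2 f u v <> 0).
  { intros u v Hb Z. destruct (He u v Hb) as [_ Hpos]. rewrite Z in Hpos. lra. }
  exists e, W, g. split; [exact OW|]. split; [exact W0|]. split; [|split; [|split]].
  - pose proof (open2_box u0 v0 e) as OB.
    assert (SB : smooth2 (box u0 v0 e) f).
    { apply smooth2_subset with (2 := Hf). intros u v Hb. now apply He. }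
    assert (S2 : smooth2 (box u0 v0 e) (fun u v => / D2 f u v)).
    { apply smooth2_inv; auto using smooth2_D2. }
    assert (S1 : smooth2 (box u0 v0 e) (fun u v => - D1 f u v * / D2 f u v)).
    { apply smooth2_mult; auto. apply smooth2_opp; auto using smooth2_D1. }
    (* Bootstrap: both partial derivatives of [g] are smooth functions of [(u, g u w)], so C^n for
       [g] yields C^n for them and C^(n+1) for [g]. *)
    intros n. induction n as [|n IH]; [exact Cont|].
    apply Ck_S_intro with (fun u w => - D1 f u (g u w) * / D2 f u (g u w))
                          (fun u w => / D2 f u (g u w)).
    + exact OW.
    + intros u w Hw. eapply differentiable_is_derive_1. now apply Diff.
    + intros u w Hw. eapply differentiable_is_derive_2. now apply Diff.
    + apply (Ck_comp n (box u0 v0 e) W (fun u v => - D1 f u v * / D2 f u v)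
               (fun u _ => u) g); auto.
      * intros u w Hw. now apply Hg.
      * now apply smooth2_fst.
    + apply (Ck_comp n (box u0 v0 e) W (fun u v => / D2 f u v)
               (fun u _ => u) g); auto.
      * intros u w Hw. now apply Hg.
      * now apply smooth2_fst.
  - intros u w Hw. destruct (Hg u w Hw) as [Hb E].
    destruct (differentiable_pt_lim_unique _ _ _ _ _ (Diff u w Hw)) as [E1 E2].
    exact (conj Hb (conj E (conj E1 E2))).
  - intros u v Hb. split; [now apply He|now apply Hne].
  - exact Inj.
Qed.

Lemma smooth2_swap (U : R -> R -> Prop) (f : R -> R -> R) :
  open2 U -> smooth2 U f ->
  open2 (fun y x => U x y) /\ smooth2 (fun y x => U x y) (fun y x => f x y).
Proof.
  intros HU Hf.
  assert (O : open2 (fun y x => U x y)).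
  { intros y x Hx. destruct (HU x y Hx) as [e He]. exists e.
    intros v u Hv Hu. now apply He. }
  split; [exact O|].
  apply (smooth2_comp U _ f (fun _ x => x) (fun y _ => y));
    auto using smooth2_fst, smooth2_snd.
Qed.

(** Elimination: [f a b = s] is solved for [b = g a s], then [h a (g a s) = y] for [a]. The
    derivative of the latter in [a] is minus the Jacobian divided by [D2 f], so both scalar problems
    are nondegenerate. *)
Lemma inverse_function_2d (U : R -> R -> Prop) (f h : R -> R -> R) (a0 b0 : R) :
  open2 U -> smooth2 U f -> smooth2 U h -> U a0 b0 -> D2 f a0 b0 <> 0 ->
  D1 f a0 b0 * D2 h a0 b0 - D2 f a0 b0 * D1 h a0 b0 <> 0 ->
  exists (e : posreal) (V : R -> R -> Prop) (p q : R -> R -> R),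
    open2 V /\ V (f a0 b0) (h a0 b0) /\ smooth2 V p /\ smooth2 V q /\
    (forall s y, V s y -> box a0 b0 e (p s y) (q s y) /\ U (p s y) (q s y) /\
       f (p s y) (q s y) = s /\ h (p s y) (q s y) = y) /\
    (forall a b, box a0 b0 e a b -> V (f a b) (h a b) ->
       p (f a b) (h a b) = a /\ q (f a b) (h a b) = b).
Proof.
  intros HU Hf Hh H0 Hfb Hjac. set (s0 := f a0 b0).
  destruct (implicit_function_scalar U f a0 b0 HU Hf H0 Hfb)
    as [e1 [W [g [OW [W0 [Sg [Hg [Hbox1 Inj1]]]]]]]].
  fold s0 in W0.
  destruct (Hg a0 s0 W0) as [Hb0 [Eg0 [Dg0 _]]].
  assert (G0 : g a0 s0 = b0) by (apply (Inj1 a0); auto using box_center).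
  set (k := fun a s => h a (g a s)).
  assert (Sk : smooth2 W k).
  { apply (smooth2_comp U W h (fun a _ => a) g); auto using smooth2_fst.
    intros a s Hw. now apply Hbox1, Hg. }
  (* The unknown [a] has to become the second argument. *)
  destruct (smooth2_swap W k OW Sk) as [OW' Sk'].
  destruct (implicit_function_scalar _ (fun s a => k a s) s0 a0 OW' Sk' W0)
    as [e2 [V0 [m [OV0 [V00 [Sm [Hm [Hbox2 Inj2]]]]]]]].
  { change (D1 k a0 s0 <> 0).
    assert (E : D1 k a0 s0 = D1 h a0 b0 * 1 + D2 h a0 b0 * D1 g a0 s0).
    { apply is_derive_unique.
      apply (is_derive_comp_2d h (fun z => z) (fun z => g z s0)).
      - rewrite G0. now apply smooth2_differentiable with U.
      - apply (is_derive_id a0).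
      - now apply (smooth2_is_derive_1 W). }
    rewrite E, Dg0, G0. intros Z. apply Hjac.
    apply (Rmult_eq_compat_r (D2 f a0 b0)) in Z.
    replace (D1 f a0 b0 * D2 h a0 b0 - D2 f a0 b0 * D1 h a0 b0)
      with (- ((D1 h a0 b0 * 1 + D2 h a0 b0 * (- D1 f a0 b0 * / D2 f a0 b0))
              * D2 f a0 b0)) by (field; exact Hfb).
    rewrite Z. ring. }
  simpl in *.
  set (q := fun s y => g (m s y) s).
  assert (Hmw : forall s y, V0 s y -> W (m s y) s).
  { intros s y Hy. destruct (Hm s y Hy) as [Hb _]. now apply Hbox2. }
  assert (Sq : smooth2 V0 q).
  { apply (smooth2_comp W V0 g m (fun s _ => s)); auto using smooth2_fst. }
  assert (L : locally_2d (fun a b => box a0 b0 e1 a b /\ Rabs (f a b - s0) < e2) a0 b0).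
  { apply locally_2d_and.
    - apply open2_box, box_center.
    - apply (smooth2_continuous U f); auto. }
  (* The final box is small enough for both uniqueness statements: [(a, b)] lies in the box of [g],
     and [(f a b, a)] in the box of [m]. *)
  assert (L2 : locally_2d (fun a b => (box a0 b0 e1 a b /\ Rabs (f a b - s0) < e2)
                                      /\ Rabs (a - a0) < e2) a0 b0).
  { apply locally_2d_and; [exact L|]. exists e2. now intros u v Hu _. }
  apply locally_2d_box in L2. destruct L2 as [e He].
  set (V := fun s y => (V0 s y /\ Rabs (m s y - a0) < e) /\ Rabs (q s y - b0) < e).
  assert (OV : open2 V).
  { unfold V. apply (open2_preimage (fun s y => V0 s y /\ Rabs (m s y - a0) < e)
      (fun z => Rabs (z - b0) < e)).
    - apply (open2_preimage V0 (fun z => Rabs (z - a0) < e)).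
      + exact OV0.
      + intros s y. now apply smooth2_continuous.
      + apply open_ball_R.
    - intros s y [Hy _]. now apply (smooth2_continuous V0).
    - apply open_ball_R. }
  assert (E00 : k a0 s0 = h a0 b0) by (unfold k; now rewrite G0).
  assert (Uniq : forall a b, box a0 b0 e a b -> V0 (f a b) (h a b) ->
       m (f a b) (h a b) = a /\ q (f a b) (h a b) = b).
  { intros a b Hab Hv. destruct (He a b Hab) as [[Hb1 Hs] Ha].
    destruct (Hm _ _ Hv) as [Hbm [Em _]].
    assert (Hb2 : box s0 a0 e2 (f a b) a) by (now split).
    destruct (Hg a (f a b)) as [Hbg [Eg _]]; [now apply Hbox2|].
    assert (Gb : g a (f a b) = b) by (now apply (Inj1 a)).
    assert (Em' : m (f a b) (h a b) = a).
    { apply (Inj2 (f a b)); auto. rewrite Em. unfold k. now rewrite Gb. }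
    split; [exact Em'|]. unfold q. now rewrite Em'. }
  assert (V000 : V0 (f a0 b0) (h a0 b0)) by (fold s0; now rewrite <- E00).
  exists e, V, m, q. split; [exact OV|]. split; [|split; [|split; [|split]]].
  - destruct (Uniq a0 b0 (box_center a0 b0 e) V000) as [E1 E2].
    fold s0 in E1, E2, V000. unfold V. rewrite E1, E2.
    split; [split; [exact V000|]|]; apply (box_center a0 b0 e).
  - apply smooth2_subset with (2 := Sm). now intros s y [[Hy _] _].
  - apply smooth2_subset with (2 := Sq). now intros s y [[Hy _] _].
  - intros s y [[Hy Hp] Hq]. split; [now split|].
    destruct (Hm s y Hy) as [_ [Ek _]].
    destruct (Hg (m s y) s (Hmw s y Hy)) as [Hb [Ef _]].
    split; [now apply Hbox1|]. split; [exact Ef|exact Ek].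
  - intros a b Hab [[Hv _] _]. now apply Uniq.
Qed.

(** * The representation yields solutions *)

Lemma is_derive_eq_loc (f g : R -> R) (s l l' : R) :
  is_derive f s l -> is_derive g s l' -> locally s (fun z => f z = g z) -> l = l'.
Proof.
  intros Hf Hg Hfg. rewrite <- (is_derive_unique g s l' Hg).
  symmetry. apply is_derive_unique. now apply is_derive_ext_loc with f.
Qed.

(* [auto_derive] leaves derivatives of variables in eta-expanded form. *)
Ltac rewrite_Derive H :=
  apply is_derive_unique in H;
  match type of H with
  | Derive ?f ?x = ?l => change (Derive (fun z : R => f z) x = l) in H
  end;
  rewrite H.

(** The values 1, -1 and 0 of [k] give the left-hand sides of the three equations; 0 also serves to
    differentiate [X - (a + b) T]. *)
Lemma is_derive_x_minus_speed_t (t x a b : R -> R) (k s t' x' a' b' : R) :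
  is_derive t s t' -> is_derive x s x' -> is_derive a s a' -> is_derive b s b' ->
  is_derive (fun z => x z - (a z + b z + k) * t z) s
    (x' - (a s + b s + k) * t' - (a' + b') * t s).
Proof.
  intros Ht Hx Ha Hb. auto_derive.
  - repeat split; [now exists x'|now exists a'|now exists b'|now exists t'].
  - rewrite_Derive Ht. rewrite_Derive Hx. rewrite_Derive Ha. rewrite_Derive Hb. ring.
Qed.

Lemma is_derive_mul_exp (G a b : R -> R) (s G' a' b' : R) :
  is_derive G s G' -> is_derive a s a' -> is_derive b s b' ->
  is_derive (fun z => G z * exp (b z - a z)) s
    ((G' + G s * (b' - a')) * exp (b s - a s)).
Proof.
  intros HG Ha Hb. auto_derive.
  - repeat split; [now exists G'|now exists b'|now exists a'].
  - rewrite_Derive HG. rewrite_Derive Ha. rewrite_Derive Hb. unfold Rminus. ring.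
Qed.

(** A curve with arbitrary [t] and [x] covers both partial derivatives of a solution: it is applied
    to the two coordinate lines. *)
Lemma representation_along_curve (U : R -> R -> Prop) (Phi : R -> R -> R)
  (F : R -> R) (t x a b c : R -> R) (s t' x' a' b' c' : R) :
  solves_Phi_eq U Phi -> U (a s) (b s) -> ex_derive F (c s) ->
  is_derive t s t' -> is_derive x s x' -> is_derive a s a' -> is_derive b s b' ->
  is_derive c s c' ->
  locally s (fun z => representation Phi F (t z) (x z) (a z) (b z) (c z)) ->
  x' - (a s + b s + 1) * t'
    = (D1 (D1 Phi) (a s) (b s) + D2 (D1 Phi) (a s) (b s)) * a' /\
  x' - (a s + b s - 1) * t'
    = - (D2 (D2 Phi) (a s) (b s) + D2 (D1 Phi) (a s) (b s)) * b' /\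
  x' - (a s + b s) * t' = Derive F (c s) * exp (b s - a s) * c'.
Proof.
  intros [HU [HPhi Heq]] Hs HF Ht Hx Ha Hb Hc Hrep.
  pose proof (is_derive_comp_2d Phi a b s _ _ _ _
    (smooth2_differentiable U Phi _ _ HU HPhi Hs) Ha Hb) as P0.
  pose proof (is_derive_comp_2d (D1 Phi) a b s _ _ _ _
    (smooth2_differentiable U _ _ _ HU (smooth2_D1 U Phi HPhi) Hs) Ha Hb) as P1.
  pose proof (is_derive_comp_2d (D2 Phi) a b s _ _ _ _
    (smooth2_differentiable U _ _ _ HU (smooth2_D2 U Phi HPhi) Hs) Ha Hb) as P2.
  rewrite (smooth2_Schwarz U Phi _ _ HU HPhi Hs) in P2.
  pose proof (is_derive_mul_exp (fun z => F (c z)) a b s _ _ _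
    (is_derive_comp F c s _ _ (Derive_correct _ _ HF) Hc) Ha Hb) as PF.
  pose proof (is_derive_x_minus_speed_t t x a b 1 s _ _ _ _ Ht Hx Ha Hb) as L1.
  pose proof (is_derive_x_minus_speed_t t x a b (-1) s _ _ _ _ Ht Hx Ha Hb) as L2.
  pose proof (is_derive_x_minus_speed_t t x a b 0 s _ _ _ _ Ht Hx Ha Hb) as L3.
  assert (E1 := is_derive_eq_loc _ _ _ _ _ L1 (is_derive_plus _ _ _ _ _ P0 P1)).
  assert (E2 := is_derive_eq_loc _ _ _ _ _ L2 (is_derive_minus _ _ _ _ _ P0 P2)).
  assert (E3 := is_derive_eq_loc _ _ _ _ _ L3 (is_derive_plus _ _ _ _ _ P0 PF)).
  assert (R0 := locally_singleton _ _ Hrep). specialize (Heq _ _ Hs).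
  unfold plus, minus, opp, scal in *; simpl in *. unfold mult, plus, opp in *; simpl in *.
  destruct R0 as [Q1 [Q2 Q3]].
  (* The first two equations give [t = - (Phi_1 + Phi_2) / 2] and [x - (a + b) t = Phi + (Phi_1 -
     Phi_2) / 2 = Phi + Phi_12]; comparison of the latter with the third equation is [Z3]. *)
  assert (Z1 : D2 Phi (a s) (b s) + D2 (D1 Phi) (a s) (b s) = - t s) by lra.
  assert (Z2 : D1 Phi (a s) (b s) - D2 (D1 Phi) (a s) (b s) = - t s) by lra.
  assert (Z3 : F (c s) * exp (b s - a s) = D2 (D1 Phi) (a s) (b s)) by lra.
  split; [|split].
  (* The added term is the contribution of the variable speed, completing the left side to a full
     derivative. On the right it cancels the cross term in [b'] and the extra part of the
     coefficient of [a']. *)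
  - rewrite Rplus_comm in Z1. apply Rplus_eq_reg_r with (- (a' + b') * t s).
    etransitivity; [|etransitivity; [apply E1|]].
    + ring.
    + revert Hrep. apply filter_imp. intros z [R1 _]. exact R1.
    + replace (t s) with (- (D2 (D1 Phi) (a s) (b s) + D2 Phi (a s) (b s))) by lra.
      replace (D1 Phi (a s) (b s)) with (D2 Phi (a s) (b s) + 2 * D2 (D1 Phi) (a s) (b s))
        by lra. ring.
  - apply Rplus_eq_reg_r with (- (a' + b') * t s).
    etransitivity; [|etransitivity; [apply E2|]].
    + ring.
    + revert Hrep. apply filter_imp. intros z [_ [R2 _]].
      replace (a z + b z + -1) with (a z + b z - 1) by ring. exact R2.
    + replace (t s) with (- (D2 (D1 Phi) (a s) (b s) + D2 Phi (a s) (b s))) by lra.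
      replace (D1 Phi (a s) (b s)) with (D2 Phi (a s) (b s) + 2 * D2 (D1 Phi) (a s) (b s))
        by lra. ring.
  - apply Rplus_eq_reg_r with (- (a' + b') * t s).
    etransitivity; [|etransitivity; [apply E3|]].
    + ring.
    + revert Hrep. apply filter_imp. intros z [_ [_ R3]].
      replace (a z + b z + 0) with (a z + b z) by ring. exact R3.
    + replace (t s) with (- (D2 (D1 Phi) (a s) (b s) + D2 Phi (a s) (b s))) by lra.
      replace (D1 Phi (a s) (b s)) with (D2 Phi (a s) (b s) + 2 * D2 (D1 Phi) (a s) (b s))
        by lra. rewrite <- Z3. ring.
Qed.

Lemma represented_solves (Omega : R -> R -> Prop) (r1 r2 r3 : R -> R -> R) :
  smooth2 Omega r1 -> smooth2 Omega r2 -> smooth2 Omega r3 ->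
  locally_represented Omega r1 r2 r3 ->
  solves_system Omega r1 r2 r3 /\
  (forall t x, Omega t x -> D2 r1 t x <> 0 /\ D2 r2 t x <> 0 /\ D2 r3 t x <> 0).
Proof.
  intros S1 S2 S3 H.
  assert (K : forall t x, Omega t x ->
    (D1 r1 t x + (r1 t x + r2 t x + 1) * D2 r1 t x = 0 /\
     D1 r2 t x + (r1 t x + r2 t x - 1) * D2 r2 t x = 0 /\
     D1 r3 t x + (r1 t x + r2 t x) * D2 r3 t x = 0) /\
    D2 r1 t x <> 0 /\ D2 r2 t x <> 0 /\ D2 r3 t x <> 0).
  { intros t x Htx.
    destruct (H t x Htx) as [U [Phi [J [F [[HPhi _] [[_ [HF _]] L]]]]]].
    destruct (locally_2d_singleton _ _ _ L) as [HUr [HJr _]].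
    assert (Lt := locally_2d_1d_const_y _ _ _ L).
    assert (Lx := locally_2d_1d_const_x _ _ _ L).
    destruct (representation_along_curve U Phi F (fun z => z) (fun _ => x)
      (fun z => r1 z x) (fun z => r2 z x) (fun z => r3 z x) t
      1 0 (D1 r1 t x) (D1 r2 t x) (D1 r3 t x)) as [T1 [T2 T3]]; auto.
    - exact (HF 1%nat _ HJr).
    - apply (is_derive_id t).
    - apply (is_derive_const x t).
    - now apply (smooth2_is_derive_1 Omega).
    - now apply (smooth2_is_derive_1 Omega).
    - now apply (smooth2_is_derive_1 Omega).
    - revert Lt. apply filter_imp. now intros z [_ [_ Hz]].
    - destruct (representation_along_curve U Phi F (fun _ => t) (fun z => z)
        (fun z => r1 t z) (fun z => r2 t z) (fun z => r3 t z) x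
        0 1 (D2 r1 t x) (D2 r2 t x) (D2 r3 t x)) as [X1 [X2 X3]]; auto.
      + exact (HF 1%nat _ HJr).
      + apply (is_derive_const t x).
      + apply (is_derive_id x).
      + now apply (smooth2_is_derive_2 Omega).
      + now apply (smooth2_is_derive_2 Omega).
      + now apply (smooth2_is_derive_2 Omega).
      + revert Lx. apply filter_imp. now intros z [_ [_ Hz]].
      + simpl in *.
        (* The t-line gives [- l = A * d1] and the x-line [1 = A * d2]. The second makes [A] and
           [d2] nonzero at this very point, and division by [A] gives the transport equation. *)
        assert (G : forall A l d1 d2, 0 - l * 1 = A * d1 -> 1 - l * 0 = A * d2 ->
          d1 + l * d2 = 0 /\ d2 <> 0).
        { intros A l d1 d2 G1 G2. split.
          - apply Rmult_eq_reg_l with A; [|intros Z; rewrite Z in G2; lra].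
            transitivity (A * d1 + l * (A * d2)); [ring|].
            rewrite <- G1, <- G2. ring.
          - intros Z. rewrite Z in G2. lra. }
        destruct (G _ _ _ _ T1 X1). destruct (G _ _ _ _ T2 X2).
        destruct (G _ _ _ _ T3 X3). easy. }
  split; intros t x Htx; now apply K.
Qed.

(** * Solutions are represented *)

Lemma smooth1_primitive (J : R -> Prop) (F m : R -> R) :
  open J -> smooth1 J m -> (forall s, J s -> is_derive F s (m s)) -> smooth1 J F.
Proof.
  intros HJ Hm HF [|[|n]] s Hs; [easy|now exists (m s); apply HF|].
  apply ex_derive_ext_loc with (Derive_n m n); [|exact (Hm (S n) s Hs)].
  assert (HD : forall z, J z -> locally z (fun y => m y = Derive F y)).
  { intros z Hz. generalize (HJ z Hz). apply filter_imp. intros y Hy.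
    symmetry. now apply is_derive_unique, HF. }
  generalize (HJ s Hs). apply filter_imp. intros z Hz.
  rewrite (Derive_n_ext_loc _ _ n z (HD z Hz)).
  rewrite <- (Nat.add_1_r n). apply (Derive_n_comp F n 1).
Qed.

Lemma smooth1_has_primitive (m : R -> R) (c0 e : R) :
  smooth1 (fun c => Rabs (c - c0) < e) m ->
  exists F, forall c, Rabs (c - c0) < e -> is_derive F c (m c).
Proof.
  intros Hm. exists (fun c => RInt m c0 c). intros c Hc.
  assert (Cm : forall z, Rabs (z - c0) < e -> continuous m z).
  { intros z Hz. apply (ex_derive_continuous m). exact (Hm 1%nat z Hz). }
  apply (is_derive_RInt m _ c0 c); [|now apply Cm].
  generalize (open_ball_R c0 e c Hc). apply filter_imp. intros z Hz.
  apply (RInt_correct m), ex_RInt_continuous. intros y Hy. apply Cm.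
  apply Rabs_def2 in Hz. revert Hy. unfold Rmin, Rmax.
  destruct (Rle_dec c0 z); intros Hy; apply Rabs_def1; lra.
Qed.

Lemma D1_zero_const (K : R -> R -> R) (t0 c0 : R) (d : posreal) :
  smooth2 (box t0 c0 d) K -> (forall t c, box t0 c0 d t c -> D1 K t c = 0) ->
  forall t c, box t0 c0 d t c -> K t c = K t0 c.
Proof.
  intros SK HK t c [Ht Hc].
  assert (In : forall z, Rmin t0 t <= z <= Rmax t0 t -> box t0 c0 d z c).
  { intros z Hz. split; [|exact Hc]. apply Rabs_def2 in Ht.
    pose proof (cond_pos d). revert Hz. unfold Rmin, Rmax.
    destruct (Rle_dec t0 t); intros Hz; apply Rabs_def1; lra. }
  destruct (MVT_gen (fun z => K z c) t0 t (fun z => D1 K z c)) as [y [Hy E]].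
  - intros z Hz. apply (smooth2_is_derive_1 (box t0 c0 d)); [exact SK|apply In; lra].
  - intros z Hz. apply continuity_pt_filterlim, (ex_derive_continuous (fun z => K z c)).
    eexists. apply (smooth2_is_derive_1 (box t0 c0 d)); [exact SK|now apply In].
  - rewrite (HK y c (In y Hy)) in E. lra.
Qed.

(** Along the third characteristic field [exp (r1 - r2)] and the x-derivative of [r3] have the same
    logarithmic derivative, minus the sum of the x-derivatives of [r1] and [r2]; hence their
    quotient [M] is constant. In the coordinates [(t, r3)] this field is the t-derivative, so
    locally [M] depends on [r3] alone and [F] is a primitive of it. *)
Lemma third_invariant_profile (Omega : R -> R -> Prop) (r1 r2 r3 : R -> R -> R)
  (t0 x0 : R) :
  open2 Omega -> smooth2 Omega r1 -> smooth2 Omega r2 -> smooth2 Omega r3 ->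
  solves_system Omega r1 r2 r3 -> (forall t x, Omega t x -> D2 r3 t x <> 0) ->
  Omega t0 x0 ->
  exists (J : R -> Prop) (F : R -> R) (N : R -> R -> Prop),
    admissible_F J F /\ open2 N /\ N t0 x0 /\
    forall t x, N t x -> Omega t x /\ J (r3 t x) /\
      Derive F (r3 t x) * D2 r3 t x = exp (r1 t x - r2 t x).
Proof.
  intros HO S1 S2 S3 Hsys Hne H0.
  set (M := fun t x => exp (r1 t x - r2 t x) * / D2 r3 t x).
  assert (SM : smooth2 Omega M).
  { apply smooth2_mult; auto.
    - apply smooth2_exp; auto using smooth2_minus.
    - apply smooth2_inv; auto using smooth2_D2. }
  assert (Mne : forall t x, Omega t x -> M t x <> 0).
  { intros t x Htx. apply Rmult_integral_contrapositive. split.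
    - apply Rgt_not_eq, exp_pos.
    - apply Rinv_neq_0_compat, Hne, Htx. }
  assert (Mcons : forall t x, Omega t x ->
    D1 M t x + (r1 t x + r2 t x) * D2 M t x = 0).
  { intros t x Htx. destruct (Hsys t x Htx) as [E1 [E2 E3]].
    pose proof (smooth2_D1 _ _ S3) as S31. pose proof (smooth2_D2 _ _ S3) as S32.
    pose proof (Hne t x Htx) as Hn.
    assert (Mgen : forall (a b c : R -> R) (s a' b' c' : R),
      is_derive a s a' -> is_derive b s b' -> is_derive c s c' -> c s <> 0 ->
      is_derive (fun z => exp (a z - b z) * / c z) s
        (exp (a s - b s) * ((a' - b') * / c s - c' * / (c s * c s)))).
    { intros a b c s a' b' c' Ha Hb Hc Hc0. auto_derive.
      - repeat split; [now exists a'|now exists b'|now exists c'|exact Hc0].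
      - rewrite_Derive Ha. rewrite_Derive Hb. rewrite_Derive Hc.
        unfold Rminus. field. exact Hc0. }
    assert (T : D1 M t x = _) by (apply is_derive_unique, (Mgen (fun z => r1 z x)
        (fun z => r2 z x) (fun z => D2 r3 z x)); [..|exact Hn];
        now apply (smooth2_is_derive_1 Omega)).
    assert (X : D2 M t x = _) by (apply is_derive_unique, (Mgen (fun z => r1 t z)
        (fun z => r2 t z) (fun z => D2 r3 t z)); [..|exact Hn];
        now apply (smooth2_is_derive_2 Omega)).
    (* The third equation differentiated in x, which is legitimate since it holds on an open set. *)
    assert (E4 : D2 (D1 r3) t x + ((D2 r1 t x + D2 r2 t x) * D2 r3 t x
                 + (r1 t x + r2 t x) * D2 (D2 r3) t x) = 0).
    { apply (is_derive_eq_loc (fun z => D1 r3 t z + (r1 t z + r2 t z) * D2 r3 t z)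
               (fun _ => 0) x).
      - apply (is_derive_plus (fun z => D1 r3 t z) (fun z => (r1 t z + r2 t z) * D2 r3 t z)).
        + now apply (smooth2_is_derive_2 Omega).
        + apply (is_derive_mult (fun z => r1 t z + r2 t z) (fun z => D2 r3 t z));
            [|now apply (smooth2_is_derive_2 Omega)|exact Rmult_comm].
          apply (is_derive_plus (fun z => r1 t z) (fun z => r2 t z));
            now apply (smooth2_is_derive_2 Omega).
      - apply (is_derive_const 0 x).
      - generalize (open2_locally_2 Omega t x HO Htx). apply filter_imp.
        intros z Hz. now apply Hsys. }
    rewrite T, X, (smooth2_Schwarz Omega r3 t x HO S3 Htx).
    replace (D2 (D1 r3) t x) with (- ((D2 r1 t x + D2 r2 t x) * D2 r3 t x
                 + (r1 t x + r2 t x) * D2 (D2 r3) t x)) by lra.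
    replace (D1 r1 t x) with (- ((r1 t x + r2 t x + 1) * D2 r1 t x)) by lra.
    replace (D1 r2 t x) with (- ((r1 t x + r2 t x - 1) * D2 r2 t x)) by lra.
    field. exact Hn. }
  destruct (implicit_function_scalar Omega r3 t0 x0 HO S3 H0 (Hne t0 x0 H0))
    as [e [W [g [OW [W0 [Sg [Hg [Hbox Inj]]]]]]]].
  set (c0 := r3 t0 x0) in *. set (K := fun t c => M t (g t c)).
  assert (SK : smooth2 W K).
  { apply (smooth2_comp Omega W M (fun t _ => t) g); auto using smooth2_fst.
    intros t c Hw. now apply Hbox, Hg. }
  (* On a box the lines of constant [c] are connected, so a vanishing t-derivative does imply
     constancy in [t]. *)
  destruct (proj1 (locally_2d_box W t0 c0) (OW t0 c0 W0)) as [d Hd].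
  assert (SKd : smooth2 (box t0 c0 d) K) by (now apply smooth2_subset with W).
  assert (Kc : forall t c, box t0 c0 d t c -> K t c = K t0 c).
  { apply D1_zero_const; [exact SKd|]. intros t c Hb. pose proof (Hd t c Hb) as Hw.
    destruct (Hg t c Hw) as [Hbg [_ [Dg _]]].
    destruct (Hbox _ _ Hbg) as [HOg Hn].
    destruct (Hsys _ _ HOg) as [_ [_ E3]].
    assert (E : D1 K t c = D1 M t (g t c) * 1 + D2 M t (g t c) * D1 g t c).
    { apply is_derive_unique. apply (is_derive_comp_2d M (fun z => z) (fun z => g z c)).
      - now apply smooth2_differentiable with Omega.
      - apply (is_derive_id t).
      - now apply (smooth2_is_derive_1 W). }
    rewrite E, Dg.
    replace (D1 r3 t (g t c)) with (- ((r1 t (g t c) + r2 t (g t c)) * D2 r3 t (g t c)))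
      by lra.
    rewrite <- (Mcons _ _ HOg). field. exact Hn. }
  set (J := fun c => Rabs (c - c0) < d).
  assert (OJ : open J) by apply open_ball_R.
  assert (Bt : forall c, J c -> box t0 c0 d t0 c).
  { intros c Hc. split; [apply (box_center t0 c0 d)|exact Hc]. }
  assert (Sm : smooth1 J (fun c => K t0 c)) by (now apply smooth2_snd_smooth1 with (box t0 c0 d)).
  destruct (smooth1_has_primitive _ _ _ Sm) as [F HF].
  (* Radius [d] and the condition on [r3] place [(t, r3)] where [K] is independent of [t]; radius
     [e] places [x] where it is the unique root recovered by [g]. *)
  set (N := fun t x => (Omega t x /\ box t0 x0 (Rmin d e) t x) /\ J (r3 t x)).
  assert (ON : open2 N).
  { apply (open2_preimage (fun t x => Omega t x /\ box t0 x0 (Rmin d e) t x) J r3).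
    - apply open2_and; [exact HO|apply open2_box].
    - intros t x [Htx _]. now apply (smooth2_continuous Omega).
    - exact OJ. }
  pose proof (Rmin_l d e) as Hmd. pose proof (Rmin_r d e) as Hme.
  exists J, F, N. split; [|split; [exact ON|split]].
  - split; [exact OJ|]. split; [now apply smooth1_primitive with (fun c => K t0 c)|].
    intros c Hc. rewrite (is_derive_unique F c _ (HF c Hc)).
    apply Mne. now apply Hbox, Hg, Hd, Bt.
  - split; [split; [exact H0|]|].
    + apply (box_center t0 x0 (mkposreal _ (Rmin_pos _ _ (cond_pos d) (cond_pos e)))).
    + apply (box_center c0 c0 d).
  - intros t x [[Htx [Ht Hx]] Hc]. split; [exact Htx|]. split; [exact Hc|].
    assert (Hb : box t0 c0 d t (r3 t x)) by (split; [lra|exact Hc]).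
    rewrite (is_derive_unique F _ _ (HF _ Hc)), <- (Kc _ _ Hb).
    destruct (Hg _ _ (Hd _ _ Hb)) as [Hbg [Eg _]].
    assert (Ex : g t (r3 t x) = x).
    { apply (Inj t); [exact Hbg| |exact Eg]. split; lra. }
    unfold K, M. rewrite Ex. field. now apply Hne.
Qed.

(** The four equations say that the Jacobian matrices of [(r1, r2)] and of its inverse multiply to
    the identity, with the t-derivatives eliminated by the system and [k = a + b]. If [t'] were
    zero, so would be [x'], contradicting the entry 1. *)
Lemma hodograph_derivatives (t' t'' x' x'' r1x r2x k : R) :
  r1x <> 0 -> r2x <> 0 ->
  - ((k + 1) * r1x) * t' + r1x * x' = 1 -> - ((k + 1) * r1x) * t'' + r1x * x'' = 0 ->
  - ((k - 1) * r2x) * t' + r2x * x' = 0 -> - ((k - 1) * r2x) * t'' + r2x * x'' = 1 ->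
  x' = (k - 1) * t' /\ x'' = (k + 1) * t'' /\ t' <> 0.
Proof.
  intros H1 H2 E1 E2 E3 E4.
  assert (X1 : x' = (k - 1) * t').
  { apply Rmult_eq_reg_l with r2x; [lra|exact H2]. }
  split; [exact X1|]. split.
  - apply Rmult_eq_reg_l with r1x; [lra|exact H1].
  - intros Z. rewrite X1, Z in E1. lra.
Qed.

Lemma exp_mul_opposite (a b : R) : exp (a - b) * exp (b - a) = 1.
Proof. rewrite <- exp_plus. replace (a - b + (b - a)) with 0 by ring. apply exp_0. Qed.

Lemma solution_represented (Omega : R -> R -> Prop) (r1 r2 r3 : R -> R -> R) :
  open2 Omega -> smooth2 Omega r1 -> smooth2 Omega r2 -> smooth2 Omega r3 ->
  solves_system Omega r1 r2 r3 ->
  (forall t x, Omega t x -> D2 r1 t x <> 0 /\ D2 r2 t x <> 0 /\ D2 r3 t x <> 0) ->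
  locally_represented Omega r1 r2 r3.
Proof.
  intros HO S1 S2 S3 Hsys Hne t0 x0 H0.
  destruct (third_invariant_profile Omega r1 r2 r3 t0 x0) as [J [F [N [HF [ON [N0 HN]]]]]];
    auto; [now intros t x Htx; apply Hne|].
  assert (S1N : smooth2 N r1) by (apply smooth2_subset with (2 := S1); intros; now apply HN).
  assert (S2N : smooth2 N r2) by (apply smooth2_subset with (2 := S2); intros; now apply HN).
  assert (S3N : smooth2 N r3) by (apply smooth2_subset with (2 := S3); intros; now apply HN).
  (* Inverting on [N] keeps [r3] at [(T, X)] inside [J], where [F] is smooth. *)
  destruct (inverse_function_2d N r1 r2 t0 x0 ON S1N S2N N0)
    as [e [V [T [X [OV [V0 [ST [SX [Hinv Huniq]]]]]]]]].
  { now apply Hne. }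
  { destruct (Hsys t0 x0 H0) as [E1 [E2 _]]. destruct (Hne t0 x0 H0) as [N1 [N2 _]].
    replace (D1 r1 t0 x0) with (- ((r1 t0 x0 + r2 t0 x0 + 1) * D2 r1 t0 x0)) by lra.
    replace (D1 r2 t0 x0) with (- ((r1 t0 x0 + r2 t0 x0 - 1) * D2 r2 t0 x0)) by lra.
    intros Z. assert (D2 r1 t0 x0 * D2 r2 t0 x0 = 0) by lra.
    now apply (Rmult_integral_contrapositive_currified _ _ N1 N2). }
  set (C := fun a b => r3 (T a b) (X a b)).
  set (Phi := fun a b => (X a b - (a + b) * T a b) - F (C a b) * exp (b - a)).
  destruct HF as [OJ [SF HF']].
  assert (SC : smooth2 V C).
  { apply (smooth2_comp N V r3 T X); auto. intros a b Hab. now apply Hinv. }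
  assert (SFC : smooth2 V (fun a b => F (C a b))).
  { apply (smooth2_comp1 J); auto. intros a b Hab. now apply HN, Hinv. }
  assert (SPhi : smooth2 V Phi).
  { pose proof (smooth2_fst V OV). pose proof (smooth2_snd V OV).
    apply smooth2_minus; auto.
    - apply smooth2_minus; auto. apply smooth2_mult; auto. now apply smooth2_plus.
    - apply smooth2_mult; auto. apply smooth2_exp; auto. now apply smooth2_minus. }
  (* The hodograph equations say [X_a - (a + b) T_a = - T_a] and [X_b - (a + b) T_b = T_b]. By the
     third equation, multiplication by the x-derivative of [r3] and by [F'], whose product is
     [exp (a - b)], turns them into the derivatives of [F (C a b)]. *)
  assert (Der : forall a b, V a b ->
    D1 X a b = (a + b - 1) * D1 T a b /\ D2 X a b = (a + b + 1) * D2 T a b /\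
    D1 T a b <> 0 /\
    is_derive (fun z => F (C z b)) a (- (exp (a - b) * D1 T a b)) /\
    is_derive (fun z => F (C a z)) b (exp (a - b) * D2 T a b)).
  { intros a b Hab. destruct (Hinv a b Hab) as [_ [HNab [Ea Eb]]].
    destruct (HN _ _ HNab) as [HOab [HJab EF]].
    destruct (Hsys _ _ HOab) as [P1 [P2 P3]]. destruct (Hne _ _ HOab) as [N1 [N2 N3]].
    pose proof (smooth2_is_derive_1 V T a b ST Hab) as T1.
    pose proof (smooth2_is_derive_2 V T a b ST Hab) as T2.
    pose proof (smooth2_is_derive_1 V X a b SX Hab) as X1.
    pose proof (smooth2_is_derive_2 V X a b SX Hab) as X2.
    assert (Chain1 : forall r, smooth2 Omega r ->
      is_derive (fun z => r (T z b) (X z b)) a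
        (D1 r (T a b) (X a b) * D1 T a b + D2 r (T a b) (X a b) * D1 X a b)).
    { intros r Sr. apply (is_derive_comp_2d r (fun z => T z b) (fun z => X z b)); auto.
      now apply smooth2_differentiable with Omega. }
    assert (Chain2 : forall r, smooth2 Omega r ->
      is_derive (fun z => r (T a z) (X a z)) b
        (D1 r (T a b) (X a b) * D2 T a b + D2 r (T a b) (X a b) * D2 X a b)).
    { intros r Sr. apply (is_derive_comp_2d r (fun z => T a z) (fun z => X a z)); auto.
      now apply smooth2_differentiable with Omega. }
    pose proof (open2_locally_1 V a b OV Hab) as La.
    pose proof (open2_locally_2 V a b OV Hab) as Lb.
    assert (A1 := is_derive_eq_loc _ (fun z => z) a _ 1 (Chain1 r1 S1) (is_derive_id a)).
    assert (A2 := is_derive_eq_loc _ (fun _ => a) b _ 0 (Chain2 r1 S1) (is_derive_const a b)).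
    assert (A3 := is_derive_eq_loc _ (fun _ => b) a _ 0 (Chain1 r2 S2) (is_derive_const b a)).
    assert (A4 := is_derive_eq_loc _ (fun z => z) b _ 1 (Chain2 r2 S2) (is_derive_id b)).
    rewrite Ea, Eb in P1, P2, P3, EF.
    replace (D1 r1 (T a b) (X a b)) with (- ((a + b + 1) * D2 r1 (T a b) (X a b)))
      in A1, A2 by lra.
    replace (D1 r2 (T a b) (X a b)) with (- ((a + b - 1) * D2 r2 (T a b) (X a b)))
      in A3, A4 by lra.
    destruct (hodograph_derivatives (D1 T a b) (D2 T a b) (D1 X a b) (D2 X a b)
      (D2 r1 (T a b) (X a b)) (D2 r2 (T a b) (X a b)) (a + b)) as [H1 [H2 H3]]; auto.
    - apply A1. revert La. apply filter_imp. intros z Hz. now apply Hinv.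
    - apply A2. revert Lb. apply filter_imp. intros z Hz. now apply Hinv.
    - apply A3. revert La. apply filter_imp. intros z Hz. now apply Hinv.
    - apply A4. revert Lb. apply filter_imp. intros z Hz. now apply Hinv.
    - assert (HFd : is_derive F (C a b) (Derive F (C a b))).
      { apply Derive_correct. exact (SF 1%nat _ HJab). }
      split; [exact H1|]. split; [exact H2|]. split; [exact H3|]. split.
      + replace (- (exp (a - b) * D1 T a b)) with
          ((D1 r3 (T a b) (X a b) * D1 T a b + D2 r3 (T a b) (X a b) * D1 X a b)
            * Derive F (C a b)).
        * apply (is_derive_comp F (fun z => C z b)); [exact HFd|]. now apply Chain1.
        * rewrite <- EF, H1.
          replace (D1 r3 (T a b) (X a b)) with (- ((a + b) * D2 r3 (T a b) (X a b))) by lra.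
          unfold C. ring.
      + replace (exp (a - b) * D2 T a b) with
          ((D1 r3 (T a b) (X a b) * D2 T a b + D2 r3 (T a b) (X a b) * D2 X a b)
            * Derive F (C a b)).
        * apply (is_derive_comp F (fun z => C a z)); [exact HFd|]. now apply Chain2.
        * rewrite <- EF, H2.
          replace (D1 r3 (T a b) (X a b)) with (- ((a + b) * D2 r3 (T a b) (X a b))) by lra.
          unfold C. ring. }
  set (E := fun a b => F (C a b) * exp (b - a)).
  assert (DE1 : forall a b, V a b -> is_derive (fun z => E z b) a (- D1 T a b - E a b)).
  { intros a b Hab. destruct (Der a b Hab) as [_ [_ [_ [Fa _]]]].
    replace (- D1 T a b - E a b) with
      ((- (exp (a - b) * D1 T a b) + F (C a b) * (0 - 1)) * exp (b - a)).
    - apply (is_derive_mul_exp (fun z => F (C z b)) (fun z => z) (fun _ => b));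
        [exact Fa|apply (is_derive_id a)|apply (is_derive_const b a)].
    - unfold E. transitivity (- (exp (a - b) * exp (b - a)) * D1 T a b
        - F (C a b) * exp (b - a)); [ring|]. rewrite exp_mul_opposite. ring. }
  assert (DE2 : forall a b, V a b -> is_derive (fun z => E a z) b (D2 T a b + E a b)).
  { intros a b Hab. destruct (Der a b Hab) as [_ [_ [_ [_ Fb]]]].
    replace (D2 T a b + E a b) with
      ((exp (a - b) * D2 T a b + F (C a b) * (1 - 0)) * exp (b - a)).
    - apply (is_derive_mul_exp (fun z => F (C a z)) (fun _ => a) (fun z => z));
        [exact Fb|apply (is_derive_const a b)|apply (is_derive_id b)].
    - unfold E. transitivity ((exp (a - b) * exp (b - a)) * D2 T a b
        + F (C a b) * exp (b - a)); [ring|]. rewrite exp_mul_opposite. ring. }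
  assert (DPhi1 : forall a b, V a b -> D1 Phi a b = E a b - T a b).
  { intros a b Hab. destruct (Der a b Hab) as [H1 _]. apply is_derive_unique.
    replace (E a b - T a b) with
      ((D1 X a b - (a + b + 0) * D1 T a b - (1 + 0) * T a b) - (- D1 T a b - E a b))
      by (rewrite H1; ring).
    apply is_derive_ext with
      (fun z => minus (X z b - (z + b + 0) * T z b) (E z b)).
    - intros z. unfold Phi, E, minus, plus, opp; simpl. ring.
    - apply (is_derive_minus (fun z => X z b - (z + b + 0) * T z b) (fun z => E z b));
        [|now apply DE1].
      apply (is_derive_x_minus_speed_t (fun z => T z b) (fun z => X z b) (fun z => z) (fun _ => b));
        [now apply (smooth2_is_derive_1 V)|now apply (smooth2_is_derive_1 V)
        |apply (is_derive_id a)|apply (is_derive_const b a)]. }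
  assert (DPhi2 : forall a b, V a b -> D2 Phi a b = - E a b - T a b).
  { intros a b Hab. destruct (Der a b Hab) as [_ [H2 _]]. apply is_derive_unique.
    replace (- E a b - T a b) with
      ((D2 X a b - (a + b + 0) * D2 T a b - (0 + 1) * T a b) - (D2 T a b + E a b))
      by (rewrite H2; ring).
    apply is_derive_ext with
      (fun z => minus (X a z - (a + z + 0) * T a z) (E a z)).
    - intros z. unfold Phi, E, minus, plus, opp; simpl. ring.
    - apply (is_derive_minus (fun z => X a z - (a + z + 0) * T a z) (fun z => E a z));
        [|now apply DE2].
      apply (is_derive_x_minus_speed_t (fun z => T a z) (fun z => X a z) (fun _ => a) (fun z => z));
        [now apply (smooth2_is_derive_2 V)|now apply (smooth2_is_derive_2 V)
        |apply (is_derive_const a b)|apply (is_derive_id b)]. }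
  assert (DPhi11 : forall a b, V a b -> D1 (D1 Phi) a b = - 2 * D1 T a b - E a b).
  { intros a b Hab.
    rewrite (D1_ext_on V (D1 Phi) (fun a b => E a b - T a b) OV DPhi1 a b Hab).
    apply is_derive_unique.
    replace (- 2 * D1 T a b - E a b) with ((- D1 T a b - E a b) - D1 T a b) by ring.
    apply (is_derive_minus (fun z => E z b) (fun z => T z b)); [now apply DE1|].
    now apply (smooth2_is_derive_1 V). }
  assert (DPhi12 : forall a b, V a b -> D2 (D1 Phi) a b = E a b).
  { intros a b Hab.
    rewrite (D2_ext_on V (D1 Phi) (fun a b => E a b - T a b) OV DPhi1 a b Hab).
    apply is_derive_unique.
    assert (Q : E a b = (D2 T a b + E a b) - D2 T a b) by ring. rewrite Q.
    apply (is_derive_minus (fun z => E a z) (fun z => T a z)); [now apply DE2|].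
    now apply (smooth2_is_derive_2 V). }
  exists V, Phi, J, F. split; [|split].
  - split; [split; [exact OV|split; [exact SPhi|]]|].
    + intros a b Hab. rewrite DPhi12, DPhi1, DPhi2 by exact Hab. ring.
    + exists (r1 t0 x0), (r2 t0 x0). split; [exact V0|]. unfold Phi11_ne.
      rewrite DPhi11, DPhi12 by exact V0. intros Z.
      destruct (Der _ _ V0) as [_ [_ [Hn _]]]. apply Hn. lra.
  - easy.
  (* The box of radius [e] makes [T] and [X] return [(t, x)] itself, and continuity of [r1] and [r2]
     keeps their values in [V]; the representation is then an identity in [Phi], [E] and [T]. *)
  - assert (L : locally_2d (fun t x => N t x /\ box t0 x0 e t x) t0 x0).
    { apply locally_2d_and; [now apply ON|apply open2_box, box_center]. }
    destruct (proj1 (locally_2d_box V _ _) (OV _ _ V0)) as [d Hd].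
    assert (C1 := smooth2_continuous N r1 t0 x0 S1N N0 d).
    assert (C2 := smooth2_continuous N r2 t0 x0 S2N N0 d).
    generalize (locally_2d_and _ _ _ _ L (locally_2d_and _ _ _ _ C1 C2)).
    apply locally_2d_impl, locally_2d_forall.
    intros t x [[HNtx Hb] [D1' D2']].
    assert (HV : V (r1 t x) (r2 t x)) by (apply Hd; now split).
    split; [exact HV|]. split; [now apply HN|].
    destruct (Huniq t x Hb HV) as [ET EX].
    unfold representation. rewrite DPhi1, DPhi2 by exact HV.
    unfold Phi, E, C. rewrite ET, EX. split; [ring|]. split; ring.
Qed.

(** * Compatibility conditions for the potential *)

Lemma is_derive_half_diff (f g : R -> R) (s f' g' : R) :
  is_derive f s f' -> is_derive g s g' ->
  is_derive (fun z => (f z - g z) / 2) s ((f' - g') / 2).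
Proof.
  intros Hf Hg. auto_derive.
  - split; [now exists f'|]. split; [now exists g'|easy].
  - rewrite_Derive Hf. rewrite_Derive Hg. field.
Qed.

(** Differentiating the equation for [Phi] gives [Phi_112 = (Phi_11 - Phi_12) / 2] and
    [Phi_122 = (Phi_12 - Phi_22) / 2]. Both claimed derivatives are the sum of these two. *)
Lemma Phi_compatibility (U : R -> R -> Prop) (Phi : R -> R -> R) (a b : R) :
  solves_Phi_eq U Phi -> U a b ->
  is_derive (fun z => D1 (D1 Phi) a z + D2 (D1 Phi) a z) b
    ((D1 (D1 Phi) a b - D2 (D2 Phi) a b) / 2) /\
  is_derive (fun z => D2 (D2 Phi) z b + D2 (D1 Phi) z b) a
    ((D1 (D1 Phi) a b - D2 (D2 Phi) a b) / 2).
Proof.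
  intros [HU [SPhi Heq]] Hab.
  set (P := D1 Phi) in *. set (Q := D2 Phi) in *.
  assert (SP : smooth2 U P) by now apply smooth2_D1.
  assert (SQ : smooth2 U Q) by now apply smooth2_D2.
  assert (Heq' : forall a b, U a b -> D2 P a b = (P a b - Q a b) / 2).
  { intros u v Huv. specialize (Heq u v Huv). lra. }
  assert (HQP : forall a b, U a b -> D1 Q a b = D2 P a b).
  { intros u v Huv. now apply (smooth2_Schwarz U Phi). }
  assert (HP1 := smooth2_is_derive_1 U P a b SP Hab).
  assert (HP2 := smooth2_is_derive_2 U P a b SP Hab).
  assert (HQ1 := smooth2_is_derive_1 U Q a b SQ Hab).
  assert (HQ2 := smooth2_is_derive_2 U Q a b SQ Hab).
  assert (E1 : D1 (D2 P) a b = (D1 P a b - D1 Q a b) / 2).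
  { rewrite (D1_ext_on U _ _ HU Heq' a b Hab). apply is_derive_unique.
    now apply is_derive_half_diff. }
  assert (E2 : D2 (D2 P) a b = (D2 P a b - D2 Q a b) / 2).
  { rewrite (D2_ext_on U _ _ HU Heq' a b Hab). apply is_derive_unique.
    now apply is_derive_half_diff. }
  assert (E3 : D2 (D1 Q) a b = D2 (D2 P) a b) by now apply (D2_ext_on U).
  split.
  - replace ((D1 P a b - D2 Q a b) / 2) with (D2 (D1 P) a b + D2 (D2 P) a b).
    + apply (is_derive_plus (fun z => D1 P a z) (fun z => D2 P a z));
        apply (smooth2_is_derive_2 U); auto using smooth2_D1, smooth2_D2.
    + rewrite <- (smooth2_Schwarz U P a b HU SP Hab), E1, E2, HQP by exact Hab. field.
  - replace ((D1 P a b - D2 Q a b) / 2) with (D1 (D2 Q) a b + D1 (D2 P) a b).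
    + apply (is_derive_plus (fun z => D2 Q z b) (fun z => D2 P z b));
        apply (smooth2_is_derive_1 U); auto using smooth2_D1, smooth2_D2.
    + rewrite (smooth2_Schwarz U Q a b HU SQ Hab), E1, E3, E2, HQP by exact Hab. field.
Qed.

Lemma nonzero_near (U : R -> R -> Prop) (A : R -> R -> R) :
  open2 U -> smooth2 U A -> open2 (fun a b => U a b /\ A a b <> 0).
Proof.
  intros HU SA. apply (open2_preimage U (fun s => s <> 0)); [exact HU| |apply open_neq].
  intros a b. now apply smooth2_continuous.
Qed.

(** Otherwise [Phi_22 + Phi_12] vanishes on the open set where [Phi_11 + Phi_12] does not. Its
    derivative in [a], half the difference of the two sums, vanishes there too, making the sums
    equal: a contradiction. *)
Lemma Phi11_ne_both (U : R -> R -> Prop) (Phi : R -> R -> R) :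
  solves_Phi_eq U Phi -> (exists a b, U a b /\ Phi11_ne Phi a b) ->
  exists a b, U a b /\ Phi11_ne Phi a b /\ Phi22_ne Phi a b.
Proof.
  intros HPhi [a [b [Hab H11]]]. apply NNPP. intros Hno.
  destruct (Phi_compatibility U Phi a b HPhi Hab) as [_ HB].
  destruct HPhi as [HU [SPhi _]].
  assert (Hnz : D1 (D1 Phi) a b + D2 (D1 Phi) a b <> 0).
  { intros Z. apply H11. lra. }
  pose proof (smooth2_D1 _ _ SPhi) as SP.
  assert (O := nonzero_near U _ HU (smooth2_plus U _ _ HU (smooth2_D1 _ _ SP) (smooth2_D2 _ _ SP))).
  assert (Z : forall u v, U u v -> D1 (D1 Phi) u v + D2 (D1 Phi) u v <> 0 ->
    D2 (D2 Phi) u v + D2 (D1 Phi) u v = 0).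
  { intros u v Huv Hn. apply NNPP. intros Hm. apply Hno. exists u, v.
    split; [exact Huv|]. split; intros Z; [apply Hn|apply Hm]; lra. }
  assert (HL := open2_locally_1 _ a b O (conj Hab Hnz)).
  assert (E := is_derive_eq_loc _ (fun _ => 0) a _ 0 HB (is_derive_const 0 a)).
  pose proof (Z a b Hab Hnz) as Z0.
  apply Hnz. enough ((D1 (D1 Phi) a b - D2 (D2 Phi) a b) / 2 = 0) by lra.
  apply E. revert HL. apply filter_imp. intros z [Hz Hn]. now apply Z.
Qed.

(** The mirror argument, with the derivative of [Phi_11 + Phi_12] in [b]. *)
Lemma Phi22_ne_both (U : R -> R -> Prop) (Phi : R -> R -> R) :
  solves_Phi_eq U Phi -> (exists a b, U a b /\ Phi22_ne Phi a b) ->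
  exists a b, U a b /\ Phi11_ne Phi a b /\ Phi22_ne Phi a b.
Proof.
  intros HPhi [a [b [Hab H22]]]. apply NNPP. intros Hno.
  destruct (Phi_compatibility U Phi a b HPhi Hab) as [HA _].
  destruct HPhi as [HU [SPhi _]].
  assert (Hnz : D2 (D2 Phi) a b + D2 (D1 Phi) a b <> 0).
  { intros Z. apply H22. lra. }
  pose proof (smooth2_D1 _ _ SPhi) as SP. pose proof (smooth2_D2 _ _ SPhi) as SQ.
  assert (O := nonzero_near U _ HU (smooth2_plus U _ _ HU (smooth2_D2 _ _ SQ) (smooth2_D2 _ _ SP))).
  assert (Z : forall u v, U u v -> D2 (D2 Phi) u v + D2 (D1 Phi) u v <> 0 ->
    D1 (D1 Phi) u v + D2 (D1 Phi) u v = 0).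
  { intros u v Huv Hn. apply NNPP. intros Hm. apply Hno. exists u, v.
    split; [exact Huv|]. split; intros Z; [apply Hm|apply Hn]; lra. }
  assert (HL := open2_locally_2 _ a b O (conj Hab Hnz)).
  assert (E := is_derive_eq_loc _ (fun _ => 0) b _ 0 HA (is_derive_const 0 b)).
  pose proof (Z a b Hab Hnz) as Z0.
  apply Hnz. enough ((D1 (D1 Phi) a b - D2 (D2 Phi) a b) / 2 = 0) by lra.
  apply E. revert HL. apply filter_imp. intros z [Hz Hn]. now apply Z.
Qed.

(** * The functions determined by the representation *)

(* The first two equations are solved for [(t, x)] as functions of [(a, b)]. *)
Definition hodo_t (Phi : R -> R -> R) (a b : R) : R :=
  (-1 / 2) * (D1 Phi a b + D2 Phi a b).

Definition hodo_x (Phi : R -> R -> R) (a b : R) : R :=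
  (Phi a b + D1 Phi a b) + (a + b + 1) * hodo_t Phi a b.

(** The triangular form: a map of [(a, b)] alone onto [(t, x)], followed by an equation for [F c]
    whose right-hand side is known once [(a, b)] is. *)
Lemma representation_hodo (Phi : R -> R -> R) (F : R -> R) (t x a b c : R) :
  representation Phi F t x a b c <->
  hodo_t Phi a b = t /\ hodo_x Phi a b = x /\
  F c = (x - (a + b) * t - Phi a b) * exp (a - b).
Proof.
  unfold representation, hodo_x, hodo_t. split.
  - intros [E1 [E2 E3]].
    assert (Et : -1 / 2 * (D1 Phi a b + D2 Phi a b) = t) by lra.
    split; [exact Et|]. rewrite Et. split; [lra|].
    replace (x - (a + b) * t - Phi a b) with (F c * exp (b - a)) by lra.
    rewrite Rmult_assoc, exp_mul_opposite. ring.
  - intros [E1 [E2 E3]]. rewrite E1 in E2. split; [lra|]. split; [lra|].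
    rewrite E3, Rmult_assoc, exp_mul_opposite. ring.
Qed.

Lemma hodo_derivatives (U : R -> R -> Prop) (Phi : R -> R -> R) (a b : R) :
  solves_Phi_eq U Phi -> U a b ->
  D1 (hodo_t Phi) a b = - (D1 (D1 Phi) a b + D2 (D1 Phi) a b) / 2 /\
  D2 (hodo_t Phi) a b = - (D2 (D2 Phi) a b + D2 (D1 Phi) a b) / 2 /\
  D1 (hodo_x Phi) a b = (a + b - 1) * D1 (hodo_t Phi) a b /\
  D2 (hodo_x Phi) a b = (a + b + 1) * D2 (hodo_t Phi) a b.
Proof.
  intros [HU [SPhi Heq]] Hab.
  pose proof (smooth2_D1 _ _ SPhi) as SP. pose proof (smooth2_D2 _ _ SPhi) as SQ.
  assert (F1 := smooth2_is_derive_1 U Phi a b SPhi Hab).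
  assert (F2 := smooth2_is_derive_2 U Phi a b SPhi Hab).
  assert (P1 := smooth2_is_derive_1 U _ a b SP Hab).
  assert (P2 := smooth2_is_derive_2 U _ a b SP Hab).
  assert (Q1 := smooth2_is_derive_1 U _ a b SQ Hab).
  assert (Q2 := smooth2_is_derive_2 U _ a b SQ Hab).
  rewrite (smooth2_Schwarz U Phi a b HU SPhi Hab) in Q1.
  specialize (Heq a b Hab).
  assert (Gt : forall (P Q : R -> R) s P' Q', is_derive P s P' -> is_derive Q s Q' ->
    is_derive (fun z => (-1 / 2) * (P z + Q z)) s (- (P' + Q') / 2)).
  { intros P Q s P' Q' HP HQ. auto_derive.
    - split; [now exists P'|]. split; [now exists Q'|easy].
    - rewrite_Derive HP. rewrite_Derive HQ. field. }
  assert (Gx : forall (f P T : R -> R) k s f' P' T',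
    is_derive f s f' -> is_derive P s P' -> is_derive T s T' ->
    is_derive (fun z => (f z + P z) + (z + k + 1) * T z) s
      (f' + P' + T s + (s + k + 1) * T')).
  { intros f P T k s f' P' T' Hf HP HT. auto_derive.
    - repeat split; [now exists f'|now exists P'|now exists T'].
    - rewrite_Derive Hf. rewrite_Derive HP. rewrite_Derive HT. ring. }
  assert (T1 : is_derive (fun z => hodo_t Phi z b) a
    (- (D1 (D1 Phi) a b + D2 (D1 Phi) a b) / 2)) by exact (Gt _ _ _ _ _ P1 Q1).
  assert (T2 : is_derive (fun z => hodo_t Phi a z) b
    (- (D2 (D1 Phi) a b + D2 (D2 Phi) a b) / 2)) by exact (Gt _ _ _ _ _ P2 Q2).
  assert (X1 := Gx _ _ _ b _ _ _ _ F1 P1 T1).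
  assert (X2 := Gx _ _ _ a _ _ _ _ F2 P2 T2).
  assert (E1 : D1 (hodo_t Phi) a b = - (D1 (D1 Phi) a b + D2 (D1 Phi) a b) / 2)
    by now apply is_derive_unique.
  assert (E2 : D2 (hodo_t Phi) a b = - (D2 (D2 Phi) a b + D2 (D1 Phi) a b) / 2).
  { rewrite (Rplus_comm (D2 (D2 Phi) a b)). now apply is_derive_unique. }
  split; [exact E1|]. split; [exact E2|]. split.
  - rewrite E1. transitivity (D1 Phi a b + D1 (D1 Phi) a b + hodo_t Phi a b
      + (a + b + 1) * (- (D1 (D1 Phi) a b + D2 (D1 Phi) a b) / 2)).
    + now apply is_derive_unique.
    + unfold hodo_t. replace (D1 Phi a b) with (2 * D2 (D1 Phi) a b + D2 Phi a b) by lra.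
      field.
  - rewrite E2. transitivity (D2 Phi a b + D2 (D1 Phi) a b + hodo_t Phi a b
      + (b + a + 1) * (- (D2 (D1 Phi) a b + D2 (D2 Phi) a b) / 2)).
    + apply is_derive_unique. revert X2. apply is_derive_ext. intros z.
      unfold hodo_x; simpl. ring.
    + unfold hodo_t. replace (D1 Phi a b) with (2 * D2 (D1 Phi) a b + D2 Phi a b) by lra.
      field.
Qed.

Lemma smooth2_hodo (U : R -> R -> Prop) (Phi : R -> R -> R) :
  open2 U -> smooth2 U Phi -> smooth2 U (hodo_t Phi) /\ smooth2 U (hodo_x Phi).
Proof.
  intros HU SPhi.
  pose proof (smooth2_D1 _ _ SPhi). pose proof (smooth2_D2 _ _ SPhi).
  assert (ST : smooth2 U (hodo_t Phi)).
  { apply smooth2_mult; auto using smooth2_const, smooth2_plus. }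
  split; [exact ST|].
  apply smooth2_plus; auto using smooth2_plus.
  apply smooth2_mult; auto.
  apply smooth2_plus; auto using smooth2_const.
  apply smooth2_plus; auto using smooth2_fst, smooth2_snd.
Qed.

(** The scalar implicit function theorem with a dummy first variable, frozen at 0. *)
Lemma inverse_function_1d (J : R -> Prop) (F : R -> R) (c0 : R) :
  open J -> smooth1 J F -> J c0 -> Derive F c0 <> 0 ->
  exists (e : posreal) (K : R -> Prop) (G : R -> R),
    open K /\ K (F c0) /\ smooth1 K G /\
    (forall w, K w -> Rabs (G w - c0) < e /\ J (G w) /\ F (G w) = w) /\
    (forall c, Rabs (c - c0) < e -> K (F c) -> G (F c) = c).
Proof.
  intros HJ SF H0 HF.
  destruct (implicit_function_scalar (fun _ v => J v) (fun _ v => F v) 0 c0)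
    as [e [W [g [OW [W0 [Sg [Hg [Hbox Inj]]]]]]]]; auto.
  - now apply open2_snd.
  - now apply smooth1_smooth2_snd.
  - assert (OK : open (W 0)).
    { intros w Hw. now apply (open2_locally_2 W). }
    exists e, (W 0), (g 0). split; [exact OK|]. split; [exact W0|]. split; [|split].
    + now apply smooth2_snd_smooth1 with W.
    + intros w Hw. destruct (Hg 0 w Hw) as [Hb [E _]].
      split; [apply Hb|]. split; [now apply (Hbox 0)|exact E].
    + intros c Hc Hw. destruct (Hg 0 (F c) Hw) as [Hb [E _]].
      apply (Inj 0); auto. split; [apply (box_center 0 0 e)|exact Hc].
Qed.

Lemma representation_determines (U : R -> R -> Prop) (Phi : R -> R -> R)
  (J : R -> Prop) (F : R -> R) (t0 x0 a0 b0 c0 : R) :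
  solves_Phi_eq U Phi -> admissible_F J F ->
  U a0 b0 -> J c0 -> Phi11_ne Phi a0 b0 -> Phi22_ne Phi a0 b0 ->
  representation Phi F t0 x0 a0 b0 c0 ->
  determines_functions U Phi J F t0 x0 a0 b0 c0.
Proof.
  intros HPhi [HJ [SF HF]] Hab Hc H11 H22 Hrep.
  destruct (hodo_derivatives U Phi a0 b0 HPhi Hab) as [DT1 [DT2 [DX1 DX2]]].
  destruct HPhi as [HU [SPhi _]].
  destruct (smooth2_hodo U Phi HU SPhi) as [ST SX].
  apply representation_hodo in Hrep. destruct Hrep as [Et [Ex Ec]].
  assert (N1 : D1 (hodo_t Phi) a0 b0 <> 0).
  { rewrite DT1. intros Z. apply H11. lra. }
  assert (N2 : D2 (hodo_t Phi) a0 b0 <> 0).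
  { rewrite DT2. intros Z. apply H22. lra. }
  destruct (inverse_function_2d U (hodo_t Phi) (hodo_x Phi) a0 b0 HU ST SX Hab N2)
    as [e1 [V [p [q [OV [V0 [Sp [Sq [Hinv Huniq]]]]]]]]].
  (* The Jacobian is [2 * T_a * T_b] with [T = hodo_t Phi]; the two inequalities on [Phi] make both
     factors nonzero. *)
  { rewrite DX1, DX2. intros Z.
    apply (Rmult_integral_contrapositive_currified _ _ N1 N2). lra. }
  destruct (Huniq a0 b0 (box_center a0 b0 e1) V0) as [Ep Eq].
  rewrite Et, Ex in V0, Ep, Eq.
  destruct (inverse_function_1d J F c0 HJ SF Hc (HF c0 Hc))
    as [e3 [K [G [OK [K0 [SG [HG HGuniq]]]]]]].
  (* The value that the third equation prescribes for [F c] once [(a, b)] is known; restricting to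
     [K (H t x)] allows [F] to be inverted on it. *)
  set (H := fun t x => (x - (p t x + q t x) * t - Phi (p t x) (q t x))
                       * exp (p t x - q t x)).
  assert (SH : smooth2 V H).
  { apply smooth2_mult; auto.
    - apply smooth2_minus; auto.
      + apply smooth2_minus; auto using smooth2_snd.
        apply smooth2_mult; auto using smooth2_plus, smooth2_fst.
      + apply (smooth2_comp U V Phi p q); auto. intros t x Hv. now apply Hinv.
    - apply smooth2_exp; auto using smooth2_minus. }
  assert (EH : H t0 x0 = F c0) by (unfold H; now rewrite Ep, Eq).
  assert (OV1 : open2 (fun t x => V t x /\ K (H t x))).
  { apply open2_preimage; auto. intros t x. now apply smooth2_continuous. }
  set (V1 := fun t x => V t x /\ K (H t x)) in *.
  assert (Sp1 : smooth2 V1 p) by (apply smooth2_subset with (2 := Sp); now intros t x [Hv _]).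
  assert (Sq1 : smooth2 V1 q) by (apply smooth2_subset with (2 := Sq); now intros t x [Hv _]).
  assert (SH1 : smooth2 V1 H) by (apply smooth2_subset with (2 := SH); now intros t x [Hv _]).
  set (r3 := fun t x => G (H t x)).
  assert (S3 : smooth2 V1 r3).
  { apply (smooth2_comp1 K); auto. now intros t x [_ Hk]. }
  assert (E3 : r3 t0 x0 = c0).
  { unfold r3. rewrite EH. apply HGuniq; [apply (box_center c0 c0 e3)|exact K0]. }
  (* A single radius within both uniqueness neighbourhoods, that of [(a0, b0)] and that of [c0];
     [Omega] is cut down so that the three functions stay within it. *)
  set (eps := mkposreal _ (Rmin_pos _ _ (cond_pos e1) (cond_pos e3))).
  assert (Heps1 : eps <= e1) by apply Rmin_l.
  assert (Heps3 : eps <= e3) by apply Rmin_r.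
  set (Omega := fun t x => ((V1 t x /\ Rabs (p t x - a0) < eps)
                 /\ Rabs (q t x - b0) < eps) /\ Rabs (r3 t x - c0) < eps).
  assert (OO : open2 Omega).
  { assert (O1 := open2_preimage V1 _ p OV1
      (fun t x => smooth2_continuous V1 p t x Sp1) (open_ball_R a0 eps)).
    assert (O2 := open2_preimage _ _ q O1
      (fun t x Hv => smooth2_continuous V1 q t x Sq1 (proj1 Hv)) (open_ball_R b0 eps)).
    exact (open2_preimage _ _ r3 O2
      (fun t x Hv => smooth2_continuous V1 r3 t x S3 (proj1 (proj1 Hv)))
      (open_ball_R c0 eps)). }
  assert (OV1sub : forall t x, Omega t x -> V1 t x) by now intros t x [[[Hv _] _] _].
  exists Omega, p, q, r3, eps. split; [exact OO|]. split.
  { unfold Omega, V1. rewrite Ep, Eq, E3, EH.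
    repeat split; auto; rewrite Rminus_diag, Rabs_R0; apply cond_pos. }
  split; [now apply smooth2_subset with V1|].
  split; [now apply smooth2_subset with V1|].
  split; [now apply smooth2_subset with V1|].
  split; [exact Ep|]. split; [exact Eq|]. split; [exact E3|].
  intros t x [[[[Hv Hk] Hp] Hq] Hr].
  destruct (Hinv t x Hv) as [_ [HUv [ET EX]]].
  destruct (HG _ Hk) as [_ [HJr EF]].
  split; [exact HUv|]. split; [exact HJr|].
  split; [exact Hp|]. split; [exact Hq|]. split; [exact Hr|].
  intros a b c _ _ Ha Hb Hcc. split.
  - intros Hrep. apply representation_hodo in Hrep. destruct Hrep as [Rt [Rx Rc]].
    destruct (Huniq a b) as [Ea Eb]; [split; lra|now rewrite Rt, Rx|].
    rewrite Rt, Rx in Ea, Eb.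
    split; [now symmetry|]. split; [now symmetry|].
    assert (EHc : H t x = F c) by (unfold H; now rewrite Ea, Eb).
    unfold r3. rewrite EHc in *. symmetry. apply HGuniq; [lra|exact Hk].
  - intros [-> [-> ->]]. apply representation_hodo.
    split; [exact ET|]. split; [exact EX|]. exact EF.
Qed.

Theorem mainTheorem9 :
  (* the general solution *)
  (forall (Omega : R -> R -> Prop) (r1 r2 r3 : R -> R -> R),
     open2 Omega ->
     smooth2 Omega r1 -> smooth2 Omega r2 -> smooth2 Omega r3 ->
     ((solves_system Omega r1 r2 r3 /\
       (forall t x, Omega t x ->
          D2 r1 t x <> 0 /\ D2 r2 t x <> 0 /\ D2 r3 t x <> 0))
      <-> locally_represented Omega r1 r2 r3))
  /\
  (* for all admissible Phi and F, the representation determines (r1, r2, r3)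
     near each of its points where neither equality holds *)
  (forall (U : R -> R -> Prop) (Phi : R -> R -> R) (J : R -> Prop) (F : R -> R),
     admissible_Phi U Phi -> admissible_F J F ->
     forall t0 x0 a0 b0 c0 : R,
       U a0 b0 -> J c0 -> Phi11_ne Phi a0 b0 -> Phi22_ne Phi a0 b0 ->
       representation Phi F t0 x0 a0 b0 c0 ->
       determines_functions U Phi J F t0 x0 a0 b0 c0)
  /\
  (* such points (a, b) exist for every admissible Phi *)
  (forall (U : R -> R -> Prop) (Phi : R -> R -> R),
     admissible_Phi U Phi ->
     exists a b, U a b /\ Phi11_ne Phi a b /\ Phi22_ne Phi a b)
  /\
  (* equivalence of the two inequalities *)
  (forall (U : R -> R -> Prop) (Phi : R -> R -> R),
     solves_Phi_eq U Phi ->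
     ((exists a b, U a b /\ Phi11_ne Phi a b) <->
      (exists a b, U a b /\ Phi22_ne Phi a b))).
Proof.
  split; [|split; [|split]].
  - intros Omega r1 r2 r3 HO S1 S2 S3. split.
    + intros [Hsys Hne]. now apply solution_represented.
    + now apply represented_solves.
  - intros U Phi J F [HPhi _] HF t0 x0 a0 b0 c0. now apply representation_determines.
  - intros U Phi [HPhi Hne]. now apply Phi11_ne_both.
  - intros U Phi HPhi. split; intros Hne.
    + destruct (Phi11_ne_both U Phi HPhi Hne) as [a [b [Hab [_ H22]]]]. now exists a, b.
    + destruct (Phi22_ne_both U Phi HPhi Hne) as [a [b [Hab [H11 _]]]]. now exists a, b.
Qed.
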